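(* The eigenfunctions $\{\psi_n(0,\lambda,x)\}$, where $\lambda=\lambda_n(0,\theta)$ runs over the real zeros of the characteristic function $\Delta_\theta(0,\lambda)$ of the operator $L_0(\theta)$, form an orthonormal basis of the space $L^2(0,l)$.
   Context: Let $\zeta_1=1$, $\zeta_2=\frac12(-1+i\sqrt3)$, $\zeta_3=\frac12(-1-i\sqrt3)$ and $s_p(z)=\frac13\sum_{k=1}^3\zeta_k^{-p}e^{z\zeta_k}$ ($p=0,1,2$). Let $0<l<\infty$ and $\theta\in\mathbb{T}=\{z\in\mathbb{C}:|z|=1\}$. $L_0(\theta)$ is the self-adjoint operator in $L^2(0,l)$, $(L_0(\theta)y)(x)=iy'''(x)$, with domain $\{y\in W_2^3(0,l):y(0)=0,\ y'(l)=\theta y'(0),\ y(l)=0\}$. Its characteristic function is $$\Delta_\theta(0,\lambda)=-\frac1{(i\lambda)^2}[\theta s_2(i\lambda l)+s_2(-i\lambda l)],$$ with (distinct) real zeros $\lambda_n(0,\theta)$, $n\in\mathbb{Z}$. For $\lambda=\lambda_n(0,\theta)$, $$\psi_n(0,\lambda,x)=\frac1{a_n}\left\{\frac{s_2(i\lambda x)}{(i\lambda)^2}\cdot\frac{s_1(i\lambda l)}{i\lambda}-\frac{s_1(i\lambda x)}{i\lambda}\cdot\frac{s_2(i\lambda l)}{(i\lambda)^2}\right\},$$ with $a_n>0$ chosen so that $\|\psi_n(0,\lambda,\cdot)\|_{L^2(0,l)}=1$. Quotients are understood by continuity at $\lambda=0$. *)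

(* Defs.v *)
From HB Require Import structures.
From mathcomp Require Import all_boot all_order all_algebra.
From mathcomp Require Import complex.
From mathcomp Require Import all_classical all_reals all_analysis.

Set Implicit Arguments.
Unset Strict Implicit.
Unset Printing Implicit Defensive.
Import Order.TTheory GRing.Theory Num.Theory.
Import numFieldNormedType.Exports.

Local Open Scope classical_set_scope.
Local Open Scope ring_scope.
Local Open Scope complex_scope.

Section L2_space.
Variables (R : realType) (l : R).
Local Notation I0l := (`]0, l[%classic : set R).

(* Elements of L^2(0,l) are represented by functions on R whose values outside
   ]0, l[ are irrelevant; equality in L^2(0,l) is equality a.e. on ]0, l[. *)
Definition L2 (f : R -> R[i]) : Prop :=
  [/\ measurable_fun I0l (fun x => complex.Re (f x)),
      measurable_fun I0l (fun x => complex.Im (f x)) &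
      (\int[lebesgue_measure]_(x in I0l) (Normc.normc (f x) ^+ 2)%:E
         < +oo)%E].

Definition Cintegral (D : set R) (f : R -> R[i]) : R[i] :=
  (\int[lebesgue_measure]_(x in D) complex.Re (f x)) +i*
  (\int[lebesgue_measure]_(x in D) complex.Im (f x)).

Definition L2dot (f g : R -> R[i]) : R[i] :=
  Cintegral I0l (fun x => f x * (g x)^*%C).

Definition L2norm (f : R -> R[i]) : R :=
  Num.sqrt (\int[lebesgue_measure]_(x in I0l) (Normc.normc (f x) ^+ 2)).

Definition L2eq (f g : R -> R[i]) : Prop :=
  {ae lebesgue_measure, forall x, x \in `]0, l[ -> f x = g x}.

Definition orthonormal_basis (I : eqType) (A : set I) (e : I -> R -> R[i]) :
    Prop :=
  [/\ forall i, A i -> L2 (e i),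
      forall i j, A i -> A j -> L2dot (e i) (e j) = (i == j)%:R &
      forall f, L2 f -> forall eps : R, 0 < eps ->
        exists (s : seq I) (c : I -> R[i]),
          (forall i, i \in s -> A i) /\
          L2norm (fun x => f x - \sum_(i <- s) c i * e i x) < eps].

(* f is absolutely continuous on [0, l] with derivative g in L^2(0,l). *)
Definition AC2 (f g : R -> R[i]) : Prop :=
  L2 g /\
  forall x, x \in `[0, l] -> f x = f 0 + Cintegral `]0, x[ g.

(* y is the continuous representative of an element of W_2^3(0,l), y1 and y2
   those of y' and y'', and y3 = y''' a.e. *)
Definition W23 (y y1 y2 y3 : R -> R[i]) : Prop :=
  [/\ AC2 y y1, AC2 y1 y2 & AC2 y2 y3].

End L2_space.

Section operator.
Variables (R : realType) (l : R) (theta : R[i]).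

(* The graph of L_0(theta): y is in the domain and L_0(theta) y = f. *)
Definition L0 (y f : R -> R[i]) : Prop :=
  exists y1 y2 y3 : R -> R[i],
    [/\ W23 l y y1 y2 y3,
        [/\ y 0 = 0, y1 l = theta * y1 0 & y l = 0] &
        L2eq l f (fun x => 'i%C * y3 x)].

Definition L0_eigenfunction (y : R -> R[i]) : Prop :=
  ~ L2eq l y (fun=> 0) /\ exists mu : R[i], L0 y (fun x => mu * y x).

End operator.

Section functions.
Variable R : realType.

Definition cexp (z : R[i]) : R[i] :=
  (expR (complex.Re z) * cos (complex.Im z)) +i*
  (expR (complex.Re z) * sin (complex.Im z)).

Definition zetas : seq R[i] :=
  [:: 1; 2^-1 * (-1 + 'i%C * (Num.sqrt 3)%:C);
         2^-1 * (-1 - 'i%C * (Num.sqrt 3)%:C)].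

Definition s_ (p : nat) (z : R[i]) : R[i] :=
  3^-1 * \sum_(zeta <- zetas) zeta ^- p * cexp (z * zeta).

(* s_p (i lambda x) / (i lambda)^p, by continuity at lambda = 0: for p < 3,
   s_p(z) = sum_n z^(3n+p) / (3n+p)!, so that the limit is x^p / p! *)
Definition sq (p : nat) (lambda : R[i]) (x : R) : R[i] :=
  if lambda == 0 then x%:C ^+ p / (p`!)%:R
  else s_ p ('i%C * lambda * x%:C) / ('i%C * lambda) ^+ p.

(* sq 2 lambda (- l) is s_2 (- i lambda l) / (i lambda)^2 *)
Definition Delta (l : R) (theta lambda : R[i]) : R[i] :=
  - (theta * sq 2 lambda l + sq 2 lambda (- l)).

Definition real_zeros (l : R) (theta : R[i]) : set R :=
  [set lambda | Delta l theta lambda%:C = 0].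

Definition psi_unnormalized (l lambda x : R) : R[i] :=
  sq 2 lambda%:C x * sq 1 lambda%:C l - sq 1 lambda%:C x * sq 2 lambda%:C l.

(* The only possible a_n > 0 making psi of norm 1 *)
Definition psi (l lambda x : R) : R[i] :=
  ((L2norm l (psi_unnormalized l lambda))%:C)^-1 * psi_unnormalized l lambda x.

End functions.

(* Main.v *)
(** With y''' = (i lambda)^3 y one has L_0(theta) y = lambda^3 y, and the
    solutions with y(0) = y(l) = 0 are the multiples of psi, because s_2(i
    lambda l) / (i lambda)^2 never vanishes for real lambda. The identity
    s_1^2 - s_0 s_2 = s_2(-z) turns the remaining condition y'(l) = theta
    y'(0) into Delta_theta(0, lambda) = 0, and orthogonality follows from
    the symmetry of L_0(theta).

    Completeness is not deduced from the compactness of the resolvent.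
    Variation of constants gives, for every real mu, a gap estimate ||w|| <=
    C ||(L_0(theta) - mu) w|| for all w in the domain (orthogonal to the
    eigenfunction of mu, if there is one). So the eigenvalues are isolated,
    and for a real mu0 outside the spectrum the bounded symmetric operator K
    = (L_0(theta) - mu0)^-1, restricted to the orthogonal complement of the
    finitely many eigenfunctions whose K-eigenvalue is at least eps in
    modulus, has norm rho <= eps: otherwise vectors u almost attaining rho
    would make (K^2 - rho^2) u arbitrarily small, against the gap estimates
    at mu0 + 1/rho and mu0 - 1/rho. Hence every element of the range of K is
    the limit of its eigenfunction expansion, and that range is dense since
    it contains the C^3 functions vanishing near 0 and l. *)
Require Import Defs.
From mathcomp Require Import all_boot all_order all_algebra.
From mathcomp Require Import complex ring lra.
From mathcomp Require Import all_classical all_reals all_analysis.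
From mathcomp Require Import measurable_realfun.

Set Implicit Arguments.
Unset Strict Implicit.
Unset Printing Implicit Defensive.
Import Order.TTheory GRing.Theory Num.Theory.
Import numFieldNormedType.Exports.

Local Open Scope classical_set_scope.
Local Open Scope ring_scope.
Local Open Scope complex_scope.

(** * Calculus of continuous complex-valued functions on the real line *)

Section real_calculus.
Variable R : realType.
Implicit Types (f g F G : R -> R) (a b x : R).
Local Notation mu := (@lebesgue_measure R).

Lemma continuous_integrable_itv f (b0 b1 : bool) a b : continuous f ->
  mu.-integrable [set` Interval (BSide b0 a) (BSide b1 b)] (EFin \o f).
Proof.
move=> cf; apply: (@integrableS _ _ _ mu `[a, b]) => //.
  by apply: subset_itv; rewrite bnd_simp; case: b0 b1 => -[].
apply: continuous_compact_integrable; first exact: segment_compact.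
exact: continuous_subspaceT.
Qed.

Lemma derive_continuous F f : (forall x, is_derive x 1 F (f x)) -> continuous F.
Proof.
by move=> dF x; exact/differentiable_continuous/derivable1_diffP.
Qed.

Lemma is_derive_scale F (k v x : R) : is_derive x 1 F v ->
  is_derive x 1 (fun y => k * F y) (k * v).
Proof.
move=> dF; apply: (is_derive_eq (is_deriveM (is_derive_cst k x (1 : R)) dF)).
by rewrite /GRing.scale /=; ring.
Qed.

Lemma is_derive_linear (k x : R) : is_derive x 1 (fun y : R => k * y) k.
Proof.
rewrite -[k in is_derive _ _ _ k]mulr1.
exact: (is_derive_scale _ (is_derive_id x (1 : R))).
Qed.

Lemma is_derive_near0 F (v x : R) : is_derive x 1 F v -> (\near x, F x = 0) -> v = 0.
Proof.
move=> dF nF; have d0 := near_eq_is_derive nF dF.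
by rewrite -(@derive_val _ _ _ _ _ _ _ d0) derive_cst.
Qed.

Lemma is_derive_increment (k k' : R -> R) (d x : R) :
  (forall y : R, is_derive y 1 k (k' y)) ->
  is_derive x 1 (fun y => d^-1 * (k (y + d) - k y)) (d^-1 * (k' (x + d) - k' x)).
Proof.
move=> dk; apply/is_derive_scale/is_deriveB.
have ds : is_derive x 1 (fun y : R => y + d) 1.
  apply: (is_derive_eq (is_deriveD (is_derive_id x 1) (is_derive_cst d x 1))).
  by rewrite addr0.
have := @is_derive1_comp _ k (fun y : R => y + d) x _ _ (dk (x + d)) ds.
by rewrite mulr1.
Qed.

Lemma Rintegral_derive F f a b : a <= b -> continuous f ->
  (forall x, is_derive x 1 F (f x)) ->
  \int[mu]_(x in `]a, b[) f x = F b - F a.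
Proof.
rewrite le_eqVlt => /predU1P[<- _ _|ab cf dF].
  by rewrite set_itv_ge ?bnd_simp// Rintegral_set0 subrr.
have cF := derive_continuous dF.
rewrite Rintegral_itv_bndo_bndc ?Rintegral_itv_obnd_cbnd;
  [|exact: continuous_integrable_itv..].
rewrite /Rintegral (@continuous_FTC2 _ f F)//.
- exact: continuous_subspaceT.
- split=> //; first by apply: cvg_at_right_filter; exact: cF.
  by apply: cvg_at_left_filter; exact: cF.
- by move=> x _; rewrite derive1E; apply: derive_val.
Qed.

(** An integral from [N] gives a primitive only to the right of [N], so the base point [- |x| - 1],
    below both 0 and [x], moves with [x]; [FE] shows that the value does not depend on it. *)
Lemma antiderivative f : continuous f ->
  exists2 F, F 0 = 0 & forall x, is_derive x 1 F (f x).
Proof.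
move=> cf.
pose G (N x : R) := \int[mu]_(t in `]N, x]) f t.
have dG (N x : R) : N < x -> is_derive x 1 (G N) (f x).
  move=> Nx.
  have xx1 : x < x + 1 by rewrite ltrDl.
  have bNx : (BRight N < BRight x)%O by rewrite bnd_simp.
  have [] := continuous_FTC1 xx1 (@continuous_integrable_itv f false false N (x + 1) cf) bNx (cf x).
  by move=> dx <-; rewrite derive1E; split.
have GB (N x y : R) : N <= x -> x <= y -> G N y - G N x = G x y.
  move=> Nx xy; rewrite /G Rintegral_itvB ?bnd_simp//.
  exact: continuous_integrable_itv.
pose F x := G (- `|x| - 1) x - G (- `|x| - 1) 0.
have FE (N x : R) : N <= 0 -> N <= x -> F x = G N x - G N 0.
  move=> N0 Nx; rewrite /F; set M := - `|x| - 1.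
  have M0 : M <= 0 by rewrite /M; have := normr_ge0 x; lra.
  have Mx : M <= x by rewrite /M; have := ler_norm (- x); rewrite normrN; lra.
  have [x0|/ltW x0] := leP 0 x; first by rewrite !GB.
  by apply/oppr_inj; rewrite !opprB !GB.
exists F; first by rewrite /F subrr.
move=> x; pose N := - `|x| - 1.
have N0 : N < 0 by rewrite /N; have := normr_ge0 x; lra.
have Nx : N < x by rewrite /N; have := ler_norm (- x); rewrite normrN; lra.
apply: (@near_eq_is_derive _ _ _ (fun y => G N y - G N 0)).
- near=> y; rewrite (FE N)//; first exact: ltW.
  by apply: ltW; near: y; exact: lt_nbhsr.
- have -> : f x = f x - 0 by rewrite subr0.
  by apply: is_deriveB; exact: dG.
Unshelve. all: by end_near. Qed.

End real_calculus.

Section complex_parts.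
Variable R : realType.
Implicit Types z w : R[i].
Local Notation Re := complex.Re.
Local Notation Im := complex.Im.

Lemma cReD z w : Re (z + w) = Re z + Re w. Proof. by case: z w => a b []. Qed.
Lemma cImD z w : Im (z + w) = Im z + Im w. Proof. by case: z w => a b []. Qed.
Lemma cReN z : Re (- z) = - Re z. Proof. by case: z. Qed.
Lemma cImN z : Im (- z) = - Im z. Proof. by case: z. Qed.
Lemma cReM z w : Re (z * w) = Re z * Re w - Im z * Im w.
Proof. by case: z w => a b []. Qed.
Lemma cImM z w : Im (z * w) = Re z * Im w + Im z * Re w.
Proof. by case: z w => a b []. Qed.
Lemma cReJ z : Re z^*%C = Re z. Proof. by case: z. Qed.
Lemma cImJ z : Im z^*%C = - Im z. Proof. by case: z. Qed.
Definition ReImE := (cReD, cImD, cReN, cImN, cReM, cImM, cReJ, cImJ).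

Lemma complexP z w : Re z = Re w -> Im z = Im w -> z = w.
Proof. by case: z w => a b [c d] /= -> ->. Qed.

Lemma cexpD z w : cexp (z + w) = cexp z * cexp w.
Proof.
rewrite /cexp; apply: complexP; rewrite [LHS]/= [RHS]ReImE [RHS]/= !ReImE.
  by rewrite expRD cosD; ring.
by rewrite expRD sinD; ring.
Qed.

Lemma cexp0 : cexp (0 : R[i]) = 1.
Proof. by apply: complexP; rewrite /= expR0 ?cos0 ?sin0 ?mulr1 ?mulr0. Qed.

Lemma normc_cexp z : Normc.normc (cexp z) = expR (Re z).
Proof.
rewrite /Normc.normc /= !exprMn -mulrDr cos2Dsin2 mulr1 sqrtr_sqr.
by rewrite ger0_norm// expR_ge0.
Qed.

End complex_parts.

Section complex_calculus.
Variable R : realType.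
Implicit Types (f g F G : R -> R[i]) (a b x : R) (c : R[i]).
Local Notation Re := complex.Re.
Local Notation Im := complex.Im.

(** Continuity here, and differentiability in [cder], are imposed on real and imaginary parts over
    the whole line, so that real calculus applies componentwise. *)
Definition ccont f :=
  continuous (fun x => Re (f x)) /\ continuous (fun x => Im (f x)).

Definition cder f g := forall x,
  is_derive x 1 (fun x => Re (f x)) (Re (g x)) /\
  is_derive x 1 (fun x => Im (f x)) (Im (g x)).

Lemma eq_cder f g F G : F =1 G -> f =1 g -> cder F f -> cder G g.
Proof. by move=> /funext-> /funext->. Qed.

Lemma cder_ccont f g : cder f g -> ccont f.
Proof. by move=> fg; split; apply: derive_continuous => x; have [] := fg x. Qed.

Lemma ccont_cst c : ccont (fun=> c).
Proof. by split; exact: cst_continuous. Qed.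

Lemma ccontD f g : ccont f -> ccont g -> ccont (fun x => f x + g x).
Proof.
move=> [fr fi] [gr gi]; split.
  under eq_fun do rewrite cReD.
  by move=> x; apply: cvgD; [exact: fr|exact: gr].
under eq_fun do rewrite cImD.
by move=> x; apply: cvgD; [exact: fi|exact: gi].
Qed.

Lemma ccontN f : ccont f -> ccont (fun x => - f x).
Proof.
move=> [fr fi]; split.
  by under eq_fun do rewrite cReN; move=> x; apply: cvgN; exact: fr.
by under eq_fun do rewrite cImN; move=> x; apply: cvgN; exact: fi.
Qed.

Lemma ccontB f g : ccont f -> ccont g -> ccont (fun x => f x - g x).
Proof. by move=> cf cg; apply: ccontD => //; exact: ccontN. Qed.

Lemma ccontM f g : ccont f -> ccont g -> ccont (fun x => f x * g x).
Proof.
move=> [fr fi] [gr gi]; split.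
  under eq_fun do rewrite cReM.
  by move=> x; apply: cvgB; apply: cvgM; do ?[exact: fr|exact: gr|exact: fi|exact: gi].
under eq_fun do rewrite cImM.
by move=> x; apply: cvgD; apply: cvgM; do ?[exact: fr|exact: gr|exact: fi|exact: gi].
Qed.

Lemma ccontZ c f : ccont f -> ccont (fun x => c * f x).
Proof. by move=> cf; apply: ccontM => //; exact: ccont_cst. Qed.

Lemma ccontJ f : ccont f -> ccont (fun x => (f x)^*%C).
Proof.
move=> [fr fi]; split; first by under eq_fun do rewrite cReJ.
by under eq_fun do rewrite cImJ; move=> x; apply: cvgN; exact: fi.
Qed.

Lemma ccont_sum (I : Type) (s : seq I) (h : I -> R -> R[i]) :
  (forall i, ccont (h i)) -> ccont (fun x => \sum_(i <- s) h i x).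
Proof.
move=> ch; elim: s => [|i s ih].
  by under eq_fun do rewrite big_nil; exact: ccont_cst.
by under eq_fun do rewrite big_cons; exact: ccontD.
Qed.

Lemma cder_cst c : cder (fun=> c) (fun=> 0).
Proof. by move=> x; split; exact: is_derive_cst. Qed.

Lemma cderD f g F G : cder F f -> cder G g ->
  cder (fun x => F x + G x) (fun x => f x + g x).
Proof.
move=> dF dG x; have [? ?] := dF x; have [? ?] := dG x; split.
  by under eq_fun do rewrite cReD; rewrite cReD; exact: is_deriveD.
by under eq_fun do rewrite cImD; rewrite cImD; exact: is_deriveD.
Qed.

Lemma cderN f F : cder F f -> cder (fun x => - F x) (fun x => - f x).
Proof.
move=> dF x; have [? ?] := dF x; split.
  by under eq_fun do rewrite cReN; rewrite cReN; exact: is_deriveN.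
by under eq_fun do rewrite cImN; rewrite cImN; exact: is_deriveN.
Qed.

Lemma cderB f g F G : cder F f -> cder G g ->
  cder (fun x => F x - G x) (fun x => f x - g x).
Proof. by move=> dF dG; apply: cderD => //; exact: cderN. Qed.

Lemma cderM f g F G : cder F f -> cder G g ->
  cder (fun x => F x * G x) (fun x => f x * G x + F x * g x).
Proof.
move=> dF dG x; have [Fr Fi] := dF x; have [Gr Gi] := dG x; split.
  under eq_fun do rewrite cReM.
  have d := is_deriveB (is_deriveM Fr Gr) (is_deriveM Fi Gi).
  apply: (is_derive_eq d).
  by rewrite !ReImE /GRing.scale /=; ring.
under eq_fun do rewrite cImM.
have d := is_deriveD (is_deriveM Fr Gi) (is_deriveM Fi Gr).
apply: (is_derive_eq d).
by rewrite !ReImE /GRing.scale /=; ring.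
Qed.

Lemma cderZ c f F : cder F f -> cder (fun x => c * F x) (fun x => c * f x).
Proof.
move=> dF; have := cderM (cder_cst c) dF.
by under [in X in _ X]eq_fun do rewrite mul0r add0r.
Qed.

Lemma cderJ f F : cder F f -> cder (fun x => (F x)^*%C) (fun x => (f x)^*%C).
Proof.
move=> dF x; have [Fr Fi] := dF x; split.
  by under eq_fun do rewrite cReJ; rewrite cReJ.
by under eq_fun do rewrite cImJ; rewrite cImJ; exact: is_deriveN.
Qed.

Lemma cder_real : cder (fun x => x%:C) (fun=> 1).
Proof. by move=> x; split; [exact: is_derive_id|exact: is_derive_cst]. Qed.

Lemma cder_cexp c :
  cder (fun x => cexp (c * x%:C)) (fun x => c * cexp (c * x%:C)).
Proof.
have E x : c * x%:C = (Re c * x) +i* (Im c * x).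
  by apply: complexP; rewrite !ReImE /= ?mulr0 ?subr0 ?add0r.
move=> x.
have de := is_derive1_comp (is_derive_expR (Re c * x)) (is_derive_linear (Re c) x).
have dc := is_derive1_comp (is_derive_cos (Im c * x)) (is_derive_linear (Im c) x).
have ds := is_derive1_comp (is_derive_sin (Im c * x)) (is_derive_linear (Im c) x).
split; under eq_fun do rewrite E; rewrite E /cexp /=.
  apply: (is_derive_eq (is_deriveM de dc)).
  by rewrite !ReImE /GRing.scale /=; ring.
apply: (is_derive_eq (is_deriveM de ds)).
by rewrite !ReImE /GRing.scale /=; ring.
Qed.

Lemma cantider f : ccont f -> exists2 F, F 0 = 0 & cder F f.
Proof.
move=> [/antiderivative[Fr Fr0 dFr] /antiderivative[Fi Fi0 dFi]].
exists (fun x => Fr x +i* Fi x); first by rewrite Fr0 Fi0.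
move=> x; split; [exact: dFr|exact: dFi].
Qed.

Lemma Cintegral_der F f a b : a <= b -> ccont f -> cder F f ->
  Cintegral `]a, b[ f = F b - F a.
Proof.
move=> ab [fr fi] dF; rewrite /Cintegral.
rewrite (Rintegral_derive ab fr (fun x => (dF x).1)).
rewrite (Rintegral_derive ab fi (fun x => (dF x).2)).
by apply: complexP; rewrite !ReImE.
Qed.

End complex_calculus.

(** * The inner product of L^2(0, l) on continuous functions *)

Section L2_continuous.
Variables (R : realType) (l : R).
Hypothesis l0 : 0 < l.
Implicit Types (f g F G : R -> R[i]) (a b x : R) (c : R[i]).
Local Notation Re := complex.Re.
Local Notation Im := complex.Im.
Local Notation normc := Normc.normc.
Local Notation mu := (@lebesgue_measure R).

Lemma sqr_normcE c : normc c ^+ 2 = Re c ^+ 2 + Im c ^+ 2.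
Proof. by case: c => a b; rewrite /= sqr_sqrtr// addr_ge0// sqr_ge0. Qed.

Lemma mulJ_normc c : c * c^*%C = (normc c ^+ 2)%:C.
Proof. by apply: complexP; rewrite sqr_normcE !ReImE /=; ring. Qed.

Lemma realCM a b : (a * b)%:C = a%:C * b%:C :> R[i].
Proof. by apply: complexP; rewrite !ReImE /=; ring. Qed.

Lemma conjcM c d : (c * d)^*%C = c^*%C * d^*%C.
Proof. by apply: complexP; rewrite !ReImE; ring. Qed.

Lemma conjcB c d : (c - d)^*%C = c^*%C - d^*%C.
Proof. by apply: complexP; rewrite !ReImE// opprD. Qed.

Lemma conjci : ('i%C)^*%C = - 'i%C :> R[i].
Proof. by apply: complexP; rewrite !ReImE /= ?oppr0. Qed.

Lemma mulii : 'i%C * 'i%C = -1 :> R[i].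
Proof. by rewrite -expr2 sqr_i. Qed.

Lemma sqr_normc_conj c : normc c ^+ 2 = Re (c * c^*%C).
Proof. by rewrite mulJ_normc. Qed.

Lemma sqr_normcD_le c d :
  normc (c + d) ^+ 2 <= 2 * normc c ^+ 2 + 2 * normc d ^+ 2.
Proof.
rewrite !sqr_normcE !ReImE -subr_ge0.
have -> : 2 * (Re c ^+ 2 + Im c ^+ 2) + 2 * (Re d ^+ 2 + Im d ^+ 2) -
  ((Re c + Re d) ^+ 2 + (Im c + Im d) ^+ 2) =
  (Re c - Re d) ^+ 2 + (Im c - Im d) ^+ 2 by ring.
by rewrite addr_ge0// sqr_ge0.
Qed.

Lemma ge0_derive_le (H h : R -> R) a b : a <= b -> continuous h ->
  (forall x, is_derive x 1 H (h x)) -> (forall x, a < x < b -> 0 <= h x) ->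
  H a <= H b.
Proof.
move=> ab ch dH h0; rewrite -subr_ge0 -(Rintegral_derive ab ch dH).
by apply: Rintegral_ge0 => x /=; rewrite in_itv; exact: h0.
Qed.

Definition cint f := Cintegral `]0, l[ f.

(** The square of [L2norm]; all estimates are made on squares, which keeps square roots out. *)
Definition sqnorm f : R := \int[mu]_(x in `]0, l[) (normc (f x) ^+ 2).

Lemma cint_der F f : ccont f -> cder F f -> cint f = F l - F 0.
Proof. by apply: Cintegral_der; exact: ltW. Qed.

(** Both sides are increments of primitives over [[0, l]], so linearity of the integral reduces to
    linearity of the derivative. *)
Lemma cintD f g : ccont f -> ccont g ->
  cint (fun x => f x + g x) = cint f + cint g.
Proof.
move=> cf cg; have [F F0 dF] := cantider cf; have [G G0 dG] := cantider cg.
rewrite (cint_der cf dF) (cint_der cg dG).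
by rewrite (cint_der (ccontD cf cg) (cderD dF dG)) F0 G0 !subr0 addr0 subr0.
Qed.

Lemma cintZ c f : ccont f -> cint (fun x => c * f x) = c * cint f.
Proof.
move=> cf; have [F F0 dF] := cantider cf.
by rewrite (cint_der cf dF) (cint_der (ccontZ c cf) (cderZ c dF)) mulrBr.
Qed.

Lemma cintJ f : ccont f -> cint (fun x => (f x)^*%C) = (cint f)^*%C.
Proof.
move=> cf; have [F F0 dF] := cantider cf.
rewrite (cint_der cf dF) (cint_der (ccontJ cf) (cderJ dF)).
by rewrite -rmorphB.
Qed.

Lemma dotDl f1 f2 g : ccont f1 -> ccont f2 -> ccont g ->
  L2dot l (fun x => f1 x + f2 x) g = L2dot l f1 g + L2dot l f2 g.
Proof.
move=> c1 c2 cg; rewrite /L2dot -cintD; [|by apply: ccontM => //; exact: ccontJ..].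
by congr Cintegral; apply/funext => x; rewrite mulrDl.
Qed.

Lemma dotZl c f g : ccont f -> ccont g ->
  L2dot l (fun x => c * f x) g = c * L2dot l f g.
Proof.
move=> cf cg; rewrite /L2dot -cintZ; last by apply: ccontM => //; exact: ccontJ.
by congr Cintegral; apply/funext => x; rewrite mulrA.
Qed.

Lemma dotC f g : ccont f -> ccont g -> L2dot l g f = (L2dot l f g)^*%C.
Proof.
move=> cf cg; rewrite /L2dot -cintJ; last by apply: ccontM => //; exact: ccontJ.
congr Cintegral; apply/funext => x.
by apply: complexP; rewrite !ReImE; ring.
Qed.

Lemma dotBl f1 f2 g : ccont f1 -> ccont f2 -> ccont g ->
  L2dot l (fun x => f1 x - f2 x) g = L2dot l f1 g - L2dot l f2 g.
Proof.
move=> c1 c2 cg; rewrite -[- L2dot l f2 g]mulN1r -dotZl// -dotDl//.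
  by congr (L2dot l _ g); apply/funext => x; rewrite mulN1r.
exact: ccontZ.
Qed.

Lemma dotZr c f g : ccont f -> ccont g ->
  L2dot l f (fun x => c * g x) = c^*%C * L2dot l f g.
Proof.
move=> cf cg; rewrite (dotC (ccontZ c cg) cf) dotZl//.
by rewrite conjcM -dotC.
Qed.

Lemma dot_suml (I : Type) (s : seq I) (h : I -> R -> R[i]) g :
  (forall i, ccont (h i)) -> ccont g ->
  L2dot l (fun x => \sum_(i <- s) h i x) g = \sum_(i <- s) L2dot l (h i) g.
Proof.
move=> ch cg; elim: s => [|i s ih].
  rewrite big_nil -[RHS](mul0r (L2dot l g g)) -dotZl//.
  by congr (L2dot l _ g); apply/funext => x; rewrite big_nil mul0r.
rewrite big_cons -ih -dotDl//; last exact: ccont_sum.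
by congr (L2dot l _ g); apply/funext => x; rewrite big_cons.
Qed.

Lemma continuous_sqr_normc f : ccont f ->
  continuous (fun x => normc (f x) ^+ 2).
Proof.
move=> cf; have [+ _] := ccontM cf (ccontJ cf).
by under eq_fun do rewrite -sqr_normc_conj.
Qed.

Lemma dotE f : L2dot l f f = (sqnorm f)%:C.
Proof.
rewrite /L2dot /Cintegral; apply: complexP => /=.
  by apply: eq_Rintegral => x _; rewrite mulJ_normc.
by under eq_Rintegral do rewrite mulJ_normc /=; rewrite /Rintegral integral0.
Qed.

Lemma sqnorm_ge0 f : 0 <= sqnorm f.
Proof. by apply: Rintegral_ge0 => x _; exact: sqr_ge0. Qed.

Lemma sqnormD f g : ccont f -> ccont g ->
  sqnorm (fun x => f x + g x) = sqnorm f + sqnorm g + 2 * Re (L2dot l f g).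
Proof.
move=> cf cg; have cfg := ccontD cf cg.
have -> : sqnorm (fun x => f x + g x) = Re (L2dot l (fun x => f x + g x) (fun x => f x + g x)).
  by rewrite dotE.
rewrite dotDl// (dotC cfg cf) (dotC cfg cg) !dotDl// !dotE (dotC cf cg).
by rewrite !ReImE /=; ring.
Qed.

Lemma sqnormZ c f : ccont f -> sqnorm (fun x => c * f x) = normc c ^+ 2 * sqnorm f.
Proof.
move=> cf; apply: complexI; rewrite realCM -!dotE dotZl//; last exact: ccontZ.
by rewrite dotZr// mulrA mulJ_normc.
Qed.

Lemma sqnormB f g : ccont f -> ccont g ->
  sqnorm (fun x => f x - g x) = sqnorm f + sqnorm g - 2 * Re (L2dot l f g).
Proof.
move=> cf cg.
have -> : (fun x => f x - g x) = (fun x => f x + (-1) * g x).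
  by apply/funext => x; rewrite mulN1r.
rewrite sqnormD//; last exact: ccontZ.
rewrite sqnormZ// dotZr// sqr_normcE !ReImE /=; ring.
Qed.

(** Parallelogram law: the difference of the two sides is the squared norm of [f - g]. *)
Lemma sqnormD_le f g : ccont f -> ccont g ->
  sqnorm (fun x => f x + g x) <= 2 * sqnorm f + 2 * sqnorm g.
Proof.
move=> cf cg; have := sqnorm_ge0 (fun x => f x - g x).
by rewrite sqnormB// sqnormD//; lra.
Qed.

Lemma sqnormB_le f g : ccont f -> ccont g ->
  sqnorm (fun x => f x - g x) <= 2 * sqnorm f + 2 * sqnorm g.
Proof.
move=> cf cg; have := sqnorm_ge0 (fun x => f x + g x).
by rewrite sqnormB// sqnormD//; lra.
Qed.

Lemma sqnorm_sup_le f M : ccont f -> (forall x, 0 < x < l -> normc (f x) ^+ 2 <= M) ->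
  sqnorm f <= l * M.
Proof.
move=> cf fM; have cn := continuous_sqr_normc cf.
have [H H0 dH] := antiderivative cn.
rewrite /sqnorm (Rintegral_derive (ltW l0) cn dH) H0 subr0.
have dK (x : R) : is_derive x 1 (fun y => M * y - H y) (M - normc (f x) ^+ 2).
  exact: (is_deriveB (is_derive_linear M x) (dH x)).
have cK : continuous (fun x => M - normc (f x) ^+ 2).
  by move=> x; apply: cvgB; [exact: cvg_cst|exact: cn].
have := ge0_derive_le (ltW l0) cK dK.
rewrite /= H0 mulr0 subrr subr_ge0 [M * l]mulrC; apply => x xl.
by rewrite subr_ge0 fM.
Qed.

(* Cauchy-Schwarz against the constant function: with c = F x / x,
   0 <= int_0^x |f - c|^2 = int_0^x |f|^2 - |F x|^2 / x. *)
Lemma antider_bound F f x : ccont f -> cder F f -> F 0 = 0 -> 0 <= x <= l ->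
  normc (F x) ^+ 2 <= l * sqnorm f.
Proof.
move=> cf dF F0 /andP[]; rewrite le_eqVlt => /predU1P[<- _|x0 xl].
  by rewrite F0 Normc.normc0 expr0n /= mulr_ge0 ?sqnorm_ge0// ltW.
have cn := continuous_sqr_normc cf.
have [H H0 dH] := antiderivative cn.
have NH : sqnorm f = H l by rewrite /sqnorm (Rintegral_derive (ltW l0) cn dH) H0 subr0.
pose c := F x / x%:C.
pose K (y : R) := H y - 2 * Re (c^*%C * F y) + normc c ^+ 2 * y.
have dK (y : R) : is_derive y 1 K (normc (f y - c) ^+ 2).
  have [dFc _] := cderZ c^*%C dF y.
  have d1 := is_derive_scale 2 dFc.
  apply: (is_derive_eq (is_deriveD (is_deriveB (dH y) d1) (is_derive_linear _ y))).
  by rewrite !sqr_normcE !ReImE /=; ring.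
have cK : continuous (fun y => normc (f y - c) ^+ 2).
  by apply: continuous_sqr_normc; apply: ccontB => //; exact: ccont_cst.
have := ge0_derive_le (ltW x0) cK dK (fun y _ => sqr_ge0 _).
have -> : K 0 = 0 by rewrite /K H0 F0 cReM /= !mulr0 subrr mulr0 subr0 addr0.
rewrite /K.
have FE : F x = x%:C * c.
  by rewrite /c mulrCA mulfV ?mulr1// -[0]/(0%:C) (inj_eq (@complexI R)) gt_eqF.
have -> : Re (c^*%C * F x) = x * normc c ^+ 2.
  by rewrite FE sqr_normcE !ReImE /=; ring.
have -> : normc (F x) ^+ 2 = x * (x * normc c ^+ 2).
  by rewrite FE !sqr_normcE !ReImE /=; ring.
have HM : H x <= H l by apply: (ge0_derive_le xl cn dH) => y _; exact: sqr_ge0.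
have Nc := sqr_ge0 (normc c).
have Hx : x * normc c ^+ 2 <= H x -> x * normc c ^+ 2 <= H l by move=> /le_trans; apply.
rewrite NH => K0; have {Hx}K1 : x * normc c ^+ 2 <= H l by apply: Hx; lra.
by apply: ler_pM => //; [exact: ltW|apply: mulr_ge0 => //; exact: ltW].
Qed.

Lemma cder_eq0_itv F f x : cder F f -> (forall y, 0 < y < l -> F y = 0) ->
  0 < x < l -> f x = 0.
Proof.
move=> dF FE xl.
have nE : \near x, F x = 0.
  near=> y; apply: FE; apply/andP; split; near: y.
    by apply: lt_nbhsr; case/andP: xl.
  by apply: lt_nbhsl; case/andP: xl.
have [dr di] := dF x.
apply: complexP; first by apply: is_derive_near0 dr _; near=> y; rewrite (near nE y).
by apply: is_derive_near0 di _; near=> y; rewrite (near nE y).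
Unshelve. all: by end_near. Qed.

Lemma ccont_eq0_itv f : ccont f -> (forall y, 0 < y < l -> f y = 0) -> f 0 = 0.
Proof.
move=> [cr ci] f0.
have z (k : R -> R) : continuous k -> (forall y, 0 < y < l -> k y = 0) -> k 0 = 0.
  move=> ck k0; have := cvg_at_right_filter (ck 0).
  suff : k x @[x --> 0^'+] --> (0 : R) by move=> h1 h2; exact: cvg_unique h2 h1.
  apply: cvg_near_cst; near=> y; apply: k0; apply/andP; split; near: y.
    exact: nbhs_right_gt.
  exact: nbhs_right_lt.
by apply: complexP; [apply: (z _ cr)|apply: (z _ ci)] => y /f0 ->.
Unshelve. all: by end_near. Qed.

(** By [antider_bound] the primitive of [f] vanishes on []0, l[], and so does its derivative [f]. *)
Lemma sqnorm_eq0 f x : ccont f -> sqnorm f = 0 -> 0 < x < l -> f x = 0.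
Proof.
move=> cf Nf; have [F F0 dF] := cantider cf; apply: (cder_eq0_itv dF) => y /andP[y0 yl].
apply: Normc.eq0_normc; apply/eqP.
rewrite -sqrf_eq0 eq_le sqr_ge0 andbT.
by rewrite -(mulr0 l) -Nf (antider_bound cf dF)// !ltW.
Qed.

End L2_continuous.

(** * The functions s_p *)

Section exponentials.
Variable R : realType.
Implicit Types (x : R) (z lam : R[i]).
Local Notation C := R[i].
Local Notation Re := complex.Re.

Definition omega : C := 2^-1 * (-1 + 'i%C * (Num.sqrt 3)%:C).
Definition omegaJ : C := 2^-1 * (-1 - 'i%C * (Num.sqrt 3)%:C).

Lemma complex_nat (n : nat) : n%:R = n%:R%:C :> C.
Proof. by rewrite rmorph_nat. Qed.

Lemma complex_real_inv (x : R) : (x%:C)^-1 = (x^-1)%:C :> C.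
Proof. by rewrite fmorphV. Qed.

Lemma omegaE : omega = (- 2^-1) +i* (2^-1 * Num.sqrt 3).
Proof.
rewrite /omega complex_nat complex_real_inv.
by apply: complexP; rewrite !ReImE /=; ring.
Qed.

Lemma omegaJE : omegaJ = -1 - omega.
Proof. by rewrite /omegaJ /omega; field. Qed.

Lemma omega_root : 1 + omega + omega ^+ 2 = 0.
Proof.
have s3 : Num.sqrt 3 ^+ 2 = 3 :> R by rewrite sqr_sqrtr// ler0n.
rewrite omegaE expr2; apply: complexP; rewrite !ReImE /=; last by field.
have -> : 2^-1 * Num.sqrt 3 * (2^-1 * Num.sqrt 3) = 4^-1 * Num.sqrt 3 ^+ 2 :> R by field.
by rewrite s3; field.
Qed.

(** Here and below, an identity that holds only modulo [1 + omega + omega ^+ 2] becomes a polynomial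
    identity once an explicit multiple of that expression is added. *)
Lemma omegaM : omega * omegaJ = 1.
Proof.
transitivity (1 - (1 + omega + omega ^+ 2)); first by rewrite omegaJE; ring.
by rewrite omega_root subr0.
Qed.

Lemma omega2 : omega ^+ 2 = omegaJ.
Proof.
transitivity (omegaJ + (1 + omega + omega ^+ 2)); first by rewrite omegaJE; ring.
by rewrite omega_root addr0.
Qed.

Lemma omegaJ2 : omegaJ ^+ 2 = omega.
Proof.
transitivity (omega + (1 + omega + omega ^+ 2)); first by rewrite omegaJE; ring.
by rewrite omega_root addr0.
Qed.

Lemma omegaV : omega^-1 = omegaJ.
Proof.
have w0 : omega != 0.
  by apply/eqP => w0; have := omegaM; rewrite w0 mul0r => /esym/eqP; rewrite oner_eq0.
by apply: (mulfI w0); rewrite mulfV// omegaM.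
Qed.

Lemma omegaJV : omegaJ^-1 = omega.
Proof. by rewrite -omegaV invrK. Qed.

Lemma s0E z : s_ 0 z = 3^-1 * (cexp z + cexp (z * omega) + cexp (z * omegaJ)).
Proof.
rewrite /s_ /zetas -/omega -/omegaJ !big_cons big_nil !expr0 !invr1 !mul1r mulr1.
by rewrite addr0 addrA.
Qed.

Lemma s1E z : s_ 1 z =
  3^-1 * (cexp z + omegaJ * cexp (z * omega) + omega * cexp (z * omegaJ)).
Proof.
rewrite /s_ /zetas -/omega -/omegaJ !big_cons big_nil !expr1 invr1 mul1r mulr1.
by rewrite addr0 addrA omegaV omegaJV.
Qed.

Lemma s2E z : s_ 2 z =
  3^-1 * (cexp z + omega * cexp (z * omega) + omegaJ * cexp (z * omegaJ)).
Proof.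
rewrite /s_ /zetas -/omega -/omegaJ !big_cons big_nil expr1n invr1 mul1r mulr1.
by rewrite addr0 addrA omega2 omegaJ2 omegaJV omegaV.
Qed.

(** Since [1 + omega + omegaJ = 0], the three exponentials in [s_ 2 (- z)] are the pairwise products
    of the exponentials [a], [b], [c] of [z]. Both sides are then quadratic in [a], [b], [c] and
    agree modulo [1 + omega + omega ^+ 2]. *)
Lemma s_wronskian z : s_ 1 z ^+ 2 - s_ 0 z * s_ 2 z = s_ 2 (- z).
Proof.
rewrite s0E s1E !s2E.
have -> : - z = z * omega + z * omegaJ by rewrite omegaJE; ring.
have -> : (z * omega + z * omegaJ) * omega = z + z * omegaJ.
  transitivity (z * (omega * omegaJ) + z * omega ^+ 2); first by ring.
  by rewrite omega2 omegaM mulr1.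
have -> : (z * omega + z * omegaJ) * omegaJ = z + z * omega.
  transitivity (z * (omega * omegaJ) + z * omegaJ ^+ 2); first by ring.
  by rewrite omegaJ2 omegaM mulr1.
rewrite !cexpD; move: (cexp z) (cexp (z * omega)) (cexp (z * omegaJ)) => a b c.
rewrite omegaJE.
transitivity (3^-1 * (b * c + omega * (a * c) + (-1 - omega) * (a * b)) +
   9^-1 * (1 + omega + omega ^+ 2) * (b ^+ 2 + c ^+ 2 - 2 * b * c)); first by field.
by rewrite omega_root mulr0 mul0r addr0.
Qed.

Lemma cder_sum3 (a b c alpha : C) :
  cder (fun x => 3^-1 * (a * cexp (alpha * x%:C) + b * cexp (alpha * x%:C * omega) +
           c * cexp (alpha * x%:C * omegaJ)))
       (fun x => 3^-1 * (a * alpha * cexp (alpha * x%:C) +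
           b * (alpha * omega) * cexp (alpha * x%:C * omega) +
           c * (alpha * omegaJ) * cexp (alpha * x%:C * omegaJ))).
Proof.
apply: cderZ.
have h (k w : C) : cder (fun x => k * cexp (alpha * x%:C * w))
    (fun x => k * (alpha * w) * cexp (alpha * x%:C * w)).
  have := cderZ k (cder_cexp (alpha * w)).
  apply: eq_cder => x; first by rewrite [alpha * w * _]mulrAC.
  by rewrite [alpha * w * _%:C]mulrAC mulrA.
have h1 : cder (fun x => a * cexp (alpha * x%:C)) (fun x => a * alpha * cexp (alpha * x%:C)).
  by apply: eq_cder (h a 1) => x; rewrite !mulr1.
by do 2![apply: cderD => //].
Qed.

(** With [cder_sq1], [cder_sq0] and the values at 0 below: [sq 0], [sq 1], [sq 2] form the
    fundamental system of [y''' = (i lam)^3 y] whose initial data [(y, y', y'')] at 0 are the unit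
    vectors. At [lam = 0] it is [1, x, x^2/2]. *)
Lemma cder_sq2 lam : cder (sq 2 lam) (sq 1 lam).
Proof.
rewrite /sq; case: eqVneq => [_|lam0].
  have H := cderZ (2^-1) (cderM (@cder_real R) (@cder_real R)).
  apply: eq_cder H => x.
    by rewrite expr2 mulrC.
  by rewrite /= expr1 invr1; field.
have a0 : 'i%C * lam != 0 by rewrite mulf_neq0// eq_complex /= oner_eq0 andbF.
have := cderZ (('i%C * lam) ^- 2) (cder_sum3 1 omega omegaJ ('i%C * lam)).
apply: eq_cder => x; first by rewrite mul1r s2E mulrC.
rewrite s1E; move: (cexp _) (cexp _) (cexp _) => c b a; move: ('i%C * lam) a0 => al al0.
transitivity (3^-1 * (a + omega ^+ 2 * b + omegaJ ^+ 2 * c) / al); first by field.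
by rewrite omega2 omegaJ2 expr1.
Qed.

Lemma cder_sq1 lam : cder (sq 1 lam) (sq 0 lam).
Proof.
rewrite /sq; case: eqVneq => [_|lam0].
  by apply: eq_cder (@cder_real R) => x; rewrite /= ?expr1 ?expr0 invr1 mulr1.
have a0 : 'i%C * lam != 0 by rewrite mulf_neq0// eq_complex /= oner_eq0 andbF.
have := cderZ (('i%C * lam) ^- 1) (cder_sum3 1 omegaJ omega ('i%C * lam)).
apply: eq_cder => x; first by rewrite mul1r s1E mulrC.
rewrite s0E; move: (cexp _) (cexp _) (cexp _) => c b a; move: ('i%C * lam) a0 => al al0.
transitivity (3^-1 * (a + omega * omegaJ * b + omega * omegaJ * c)); first by field.
by rewrite omegaM !mul1r expr0 divr1.
Qed.

Lemma cder_sq0 lam : cder (sq 0 lam) (fun x => ('i%C * lam) ^+ 3 * sq 2 lam x).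
Proof.
rewrite /sq; case: eqVneq => [->|lam0].
  apply: eq_cder (cder_cst 1) => x; first by rewrite expr0 divr1.
  by rewrite mulr0 expr0n mul0r.
have a0 : 'i%C * lam != 0 by rewrite mulf_neq0// eq_complex /= oner_eq0 andbF.
apply: eq_cder (cder_sum3 1 1 1 ('i%C * lam)) => x.
  by rewrite !mul1r s0E expr0 divr1.
by rewrite s2E; move: (cexp _) (cexp _) (cexp _) => c b a; move: ('i%C * lam) a0 => al al0; field.
Qed.

Lemma sq2_0 lam : sq 2 lam (0 : R) = 0.
Proof.
rewrite /sq; case: eqVneq => _; first by rewrite expr0n mul0r.
rewrite mulr0 s2E !mul0r cexp0 !mulr1 omegaJE.
by rewrite [1 + _ + _](_ : _ = 0) ?mulr0 ?mul0r//; ring.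
Qed.

Lemma sq1_0 lam : sq 1 lam (0 : R) = 0.
Proof.
rewrite /sq; case: eqVneq => _; first by rewrite expr0n mul0r.
rewrite mulr0 s1E !mul0r cexp0 !mulr1 omegaJE.
by rewrite [1 + _ + _](_ : _ = 0) ?mulr0 ?mul0r//; ring.
Qed.

Lemma sq0_0 lam : sq 0 lam (0 : R) = 1.
Proof.
rewrite /sq; case: eqVneq => _; first by rewrite expr0 divr1.
by rewrite mulr0 s0E !mul0r cexp0; field.
Qed.

Lemma sq_wronskian lam x :
  sq 1 lam x ^+ 2 - sq 0 lam x * sq 2 lam x = sq 2 lam (- x).
Proof.
rewrite /sq; case: eqVneq => [_|lam0].
  by rewrite rmorphN !factS fact0 !muln1; field.
have a0 : 'i%C * lam != 0 by rewrite mulf_neq0// eq_complex /= oner_eq0 andbF.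
rewrite rmorphN mulrN -s_wronskian; move: ('i%C * lam) a0 => al al0.
by field.
Qed.

(** For real [t], negating [i t] is conjugating it, and conjugation swaps the [omega] and [omegaJ]
    terms of [s_ 2]. *)
Lemma s2J (t : R) : s_ 2 (- ('i%C * t%:C)) = (s_ 2 ('i%C * t%:C))^*%C.
Proof.
have cJ z : cexp z^*%C = (cexp z)^*%C.
  by apply: complexP; rewrite ?cReJ ?cImJ /= ?cReJ ?cImJ ?cosN ?sinN ?mulrN.
have zJ : - ('i%C * t%:C) = ('i%C * t%:C)^*%C.
  by apply: complexP; rewrite !ReImE /=; ring.
have wJ : omega^*%C = omegaJ.
  by rewrite omegaJE omegaE; apply: complexP; rewrite !ReImE /=; field.
have wJJ : omegaJ^*%C = omega.
  by rewrite -wJ; apply: complexP; rewrite !ReImE ?opprK.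
have tJ : (3^-1)^*%C = 3^-1 :> C.
  by rewrite complex_nat complex_real_inv; apply: complexP; rewrite !ReImE /= ?oppr0.
have DJ z z' : (z + z')^*%C = z^*%C + z'^*%C.
  by apply: complexP; rewrite !ReImE ?opprD.
have OJ u : (omega * u)^*%C = omegaJ * u^*%C by rewrite (conjcM omega u) wJ.
have OJJ u : (omegaJ * u)^*%C = omega * u^*%C by rewrite (conjcM omegaJ u) wJJ.
rewrite !s2E (conjcM 3^-1) tJ !DJ OJ OJJ -!cJ ![_ * omega]mulrC ![_ * omegaJ]mulrC.
by rewrite OJ OJJ -zJ; ring.
Qed.

(** A zero of [s_ 2] at [i t] is by [s2J] also one at [- i t], so [s_wronskian] makes [s_ 1] vanish
    too. The two linear relations force [a = b], and comparing the moduli of these exponentials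
    gives [t = 0]. *)
Lemma s2_neq0 (t : R) : t != 0 -> s_ 2 ('i%C * t%:C) != 0.
Proof.
move=> t0; apply/eqP => s20; have s10 : s_ 1 ('i%C * t%:C) = 0.
  apply/eqP; rewrite -sqrf_eq0; have := s_wronskian ('i%C * t%:C).
  by rewrite s2J s20 mulr0 subr0 => ->; apply/eqP; apply: complexP; rewrite ?cReJ ?cImJ ?oppr0.
move: s10 s20; rewrite s1E s2E.
set z := 'i%C * t%:C; set a := cexp z; set b := cexp (z * omega); set c := cexp _.
have n3 : (3^-1 : C) != 0 by rewrite invr_neq0// pnatr_eq0.
move=> /eqP; rewrite mulf_eq0 (negbTE n3) /= => /eqP e1.
move=> /eqP; rewrite mulf_eq0 (negbTE n3) /= => /eqP e2.
have ab : a = b.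
  apply/eqP; rewrite -subr_eq0; apply/eqP.
  (* Elimination of [c] between the two relations; the factor 3 is [- (omega - omegaJ)^2]. *)
  have : 3 * (a - b) = (omega - omegaJ) * (omegaJ * (a + omegaJ * b + omega * c)
     - omega * (a + omega * b + omegaJ * c)).
    transitivity ((omega - omegaJ) * (omegaJ * (a + omegaJ * b + omega * c)
     - omega * (a + omega * b + omegaJ * c)) + 4 * (1 + omega + omega ^+ 2) * (a - b)).
      by rewrite omegaJE; ring.
    by rewrite omega_root mulr0 mul0r addr0.
  by rewrite e1 e2 !mulr0 subr0 mulr0 => /eqP; rewrite mulf_eq0 pnatr_eq0 /= => /eqP.
have : Normc.normc a = Normc.normc b by rewrite ab.
rewrite !normc_cexp => /expR_inj.
have -> : Re z = 0 by rewrite /z !ReImE /=; ring.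
have -> : Re (z * omega) = t * (- (2^-1 * Num.sqrt 3)).
  by rewrite /z omegaE !ReImE /=; ring.
move=> /esym/eqP; rewrite mulf_eq0 (negbTE t0) oppr_eq0 mulf_eq0 invr_eq0 pnatr_eq0 /=.
by rewrite sqrtr_eq0 leNgt ltr0n.
Qed.

Lemma sq2_neq0 (t x : R) : 0 < x -> sq 2 t%:C x != 0.
Proof.
move=> x0; have c0 (a : R) : a != 0 -> a%:C != 0 :> C.
  by apply: contra_neq => /complexI.
rewrite /sq; case: (eqVneq t%:C 0) => [_|t0].
  by rewrite mulf_neq0 ?invr_neq0 ?pnatr_eq0// expf_neq0// c0// gt_eqF.
have t0' : t != 0 by apply: contra_neq t0 => ->.
have i0 : 'i%C * t%:C != 0 by rewrite mulf_neq0// eq_complex /= oner_eq0 andbF.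
apply: mulf_neq0; last by rewrite invr_neq0// expf_neq0.
by rewrite -mulrA -realCM s2_neq0// mulf_neq0// gt_eqF.
Qed.

End exponentials.

(** * The equation y''' - alpha^3 y = g *)

Section linear_ode.
Variables (R : realType) (l : R).
Hypothesis l0 : 0 < l.
Implicit Types (f g u v w F G : R -> R[i]) (x : R) (alpha : R[i]).
Local Notation C := R[i].
Local Notation Re := complex.Re.
Local Notation normc := Normc.normc.

Lemma sqnorm_le f g M : ccont f -> ccont g ->
  (forall x, 0 < x < l -> normc (f x) ^+ 2 <= M * normc (g x) ^+ 2) ->
  sqnorm l f <= M * sqnorm l g.
Proof.
move=> cf cg fg; have ig := continuous_integrable_itv false true 0 l (continuous_sqr_normc cg).
rewrite /sqnorm -RintegralZl//.
apply: le_Rintegral => //.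
- exact/continuous_integrable_itv/continuous_sqr_normc.
- apply: continuous_integrable_itv => x; apply: cvgM; first exact: cvg_cst.
  exact: continuous_sqr_normc.
Qed.

Definition expbound alpha : R := expR (2 * `|Re alpha| * l).

Lemma cexp_bound alpha x : 0 <= x <= l ->
  normc (cexp (alpha * x%:C)) ^+ 2 <= expbound alpha.
Proof.
move=> /andP[x0 xl]; rewrite normc_cexp expr2 -expRD ler_expR.
have -> : Re (alpha * x%:C) = Re alpha * x by rewrite !ReImE /=; ring.
have : Re alpha * x <= `|Re alpha| * l.
  by apply: le_trans (ler_wpM2l _ xl) => //; rewrite ler_wpM2r// ler_norm.
lra.
Qed.

Lemma cder_cexpM alpha f F : cder F f ->
  cder (fun x => cexp (alpha * x%:C) * F x)
    (fun x => cexp (alpha * x%:C) * (f x + alpha * F x)).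
Proof.
by move=> dF; apply: eq_cder (cderM (cder_cexp alpha) dF) => x //; ring.
Qed.

Lemma ccont_cexp alpha : ccont (fun x => cexp (alpha * x%:C)).
Proof. exact: cder_ccont (cder_cexp alpha). Qed.

(** Integrating factor: [w] is [exp(alpha x)] times the primitive of [exp(- alpha x) g]. *)
Lemma order1_solution alpha g : ccont g ->
  exists2 w, w 0 = 0 & cder w (fun x => alpha * w x + g x).
Proof.
move=> cg.
have [F F0 dF] := cantider (ccontM (ccont_cexp (- alpha)) cg).
exists (fun x => cexp (alpha * x%:C) * F x); first by rewrite F0 mulr0.
apply: eq_cder (cder_cexpM alpha dF) => // x.
by rewrite mulrDr mulrA -cexpD mulNr subrr cexp0 mul1r addrC mulrCA.
Qed.

Definition order1_const alpha : R :=
  expbound alpha * (l * expbound (- alpha)).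

Lemma order1_const_ge0 alpha : 0 <= order1_const alpha.
Proof. by rewrite !mulr_ge0// ?expR_ge0// ltW. Qed.

(** [exp(- alpha x) w] is the primitive of [exp(- alpha x) g] vanishing at 0, so [antider_bound]
    applies; removing the exponentials costs [expbound alpha] and [expbound (- alpha)]. *)
Lemma order1_bound alpha w g x : ccont g -> w 0 = 0 ->
  cder w (fun x => alpha * w x + g x) -> 0 <= x <= l ->
  normc (w x) ^+ 2 <= order1_const alpha * sqnorm l g.
Proof.
move=> cg w0 dw xl.
have cE := ccontM (ccont_cexp (- alpha)) cg.
have dF : cder (fun x => cexp (- alpha * x%:C) * w x) (fun x => cexp (- alpha * x%:C) * g x).
  by apply: eq_cder (cder_cexpM (- alpha) dw) => // y; rewrite mulNr; ring.
have -> : w x = cexp (alpha * x%:C) * (cexp (- alpha * x%:C) * w x).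
  by rewrite mulrA -cexpD mulNr subrr cexp0 mul1r.
rewrite Normc.normcM exprMn /order1_const -mulrA ler_pM ?sqr_ge0//.
  exact: cexp_bound.
have := antider_bound l0 cE dF; rewrite w0 mulr0 => /(_ x erefl xl) /le_trans; apply.
rewrite -mulrA ler_wpM2l ?(ltW l0)//.
apply: sqnorm_le => // y /andP[y0 yl].
by rewrite Normc.normcM exprMn ler_wpM2r ?sqr_ge0// cexp_bound// !ltW.
Qed.

Lemma order1_sqnorm_bound alpha w g : ccont g -> w 0 = 0 ->
  cder w (fun x => alpha * w x + g x) ->
  sqnorm l w <= l * order1_const alpha * sqnorm l g.
Proof.
move=> cg w0 dw; rewrite -mulrA; apply: (sqnorm_sup_le l0); first exact: cder_ccont dw.
by move=> x /andP[x0 xl]; apply: order1_bound => //; rewrite !ltW.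
Qed.

(* y''' - alpha^3 y = g is solved through the factorization of
   D^3 - alpha^3 = (D - alpha) (D - alpha omega) (D - alpha omega^2). *)
Lemma order3_solution alpha g : ccont g -> exists w w1 w2 w3,
  [/\ cder w w1, cder w1 w2, cder w2 w3,
      (forall x, w3 x = alpha ^+ 3 * w x + g x) &
      [/\ w 0 = 0, w1 0 = 0 & w2 0 = 0]].
Proof.
move=> cg; have [u u0 du] := order1_solution (alpha * omegaJ R) cg.
have [v v0 dv] := order1_solution (alpha * omega R) (cder_ccont du).
have [w w0 dw] := order1_solution alpha (cder_ccont dv).
pose w1 x := alpha * w x + v x.
pose w2 x := alpha * w1 x + (alpha * omega R * v x + u x).
pose w3 x := alpha * w2 x + (alpha * omega R * (alpha * omega R * v x + u x) +
                             (alpha * omegaJ R * u x + g x)).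
have dw1 : cder w1 w2 by apply: cderD => //; exact: cderZ.
exists w, w1, w2, w3; split=> //.
- by apply: cderD; [exact: cderZ|apply: cderD => //; exact: cderZ].
- move=> x; rewrite /w3 /w2 /w1.
  transitivity (alpha ^+ 3 * w x + g x +
     alpha ^+ 2 * (1 + omega R + omega R ^+ 2) * v x + alpha * (1 + omega R + omegaJ R) * u x).
    by ring.
  by rewrite omega_root omegaJE; ring.
- by split=> //; rewrite /w2 /w1 w0 v0 ?u0; ring.
Qed.

(** The factors of [D^3 - alpha^3] are peeled off and [order1_bound] is used three times. The
    derivative is bounded as well because a boundary condition involves [y'(l)]. *)
Lemma order3_bound alpha : exists2 K, 0 <= K &
  forall w w1 w2 w3 g, ccont g -> cder w w1 -> cder w1 w2 -> cder w2 w3 ->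
  (forall x, w3 x = alpha ^+ 3 * w x + g x) ->
  w 0 = 0 -> w1 0 = 0 -> w2 0 = 0 ->
  forall x, 0 <= x <= l ->
  normc (w x) ^+ 2 <= K * sqnorm l g /\ normc (w1 x) ^+ 2 <= K * sqnorm l g.
Proof.
pose a2 := alpha * omega R; pose a3 := alpha * omegaJ R.
pose K3 := order1_const a3; pose K2 := order1_const a2; pose K1 := order1_const alpha.
have K10 : 0 <= K1 := order1_const_ge0 _.
have K20 : 0 <= K2 := order1_const_ge0 _.
have K30 : 0 <= K3 := order1_const_ge0 _.
have L0 := ltW l0.
(* Relative to [sqnorm l g], [A] will bound the square of [v = (D - alpha) w] and [B] that of [w];
   each [l] comes from passing from a pointwise bound to a norm. *)
pose A := K2 * (l * K3); pose B := K1 * (l * A).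
have A0 : 0 <= A by do 2![apply: mulr_ge0 => //].
have B0 : 0 <= B by do 2![apply: mulr_ge0 => //].
have na0 := sqr_ge0 (normc alpha).
exists (2 * normc alpha ^+ 2 * B + 2 * A + B).
  by do 2![apply: addr_ge0 => //]; do ?[apply: mulr_ge0 => //].
move=> w w1 w2 w3 g cg dw dw1 dw2 w3E w0 w10 w20 x xl.
pose v y := w1 y - alpha * w y.
pose u y := w2 y - alpha * w1 y - a2 * v y.
have dv : cder v (fun y => a2 * v y + u y).
  by apply: eq_cder (cderB dw1 (cderZ alpha dw)) => // y; rewrite /u; ring.
have du : cder u (fun y => a3 * u y + g y).
  apply: eq_cder (cderB (cderB dw2 (cderZ alpha dw1)) (cderZ a2 dv)) => // y.
  rewrite w3E /u /v /a2 /a3.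
  transitivity (alpha * omegaJ R * (w2 y - alpha * w1 y - alpha * omega R * (w1 y - alpha * w y)) + g y
    + alpha ^+ 2 * (omega R * omegaJ R - 1) * (w1 y - alpha * w y)
    - alpha * (1 + omega R + omegaJ R) * (w2 y - alpha * w1 y)); last first.
    by rewrite omegaM omegaJE; ring.
  by ring.
have dw' : cder w (fun y => alpha * w y + v y).
  by apply: eq_cder dw => // y; rewrite /v; ring.
have v0 : v 0 = 0 by rewrite /v w0 w10; ring.
have u0 : u 0 = 0 by rewrite /u v0 w10 w20; ring.
have cu := cder_ccont du; have cv := cder_ccont dv.
have Nu : sqnorm l u <= l * K3 * sqnorm l g by exact: order1_sqnorm_bound.
have Ng := sqnorm_ge0 l g.
have bv y : 0 <= y <= l -> normc (v y) ^+ 2 <= A * sqnorm l g.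
  move=> yl; apply: le_trans (order1_bound cu v0 dv yl) _.
  have -> : A * sqnorm l g = K2 * (l * K3 * sqnorm l g) by rewrite /A; ring.
  exact: ler_wpM2l.
have Nv : sqnorm l v <= l * (A * sqnorm l g).
  by apply: (sqnorm_sup_le l0) => // y /andP[y0 yl]; apply: bv; rewrite !ltW.
have bw : normc (w x) ^+ 2 <= B * sqnorm l g.
  apply: le_trans (order1_bound cv w0 dw' xl) _.
  have -> : B * sqnorm l g = K1 * (l * (A * sqnorm l g)) by rewrite /B; ring.
  exact: ler_wpM2l.
have BN : 0 <= B * sqnorm l g by rewrite mulr_ge0.
have AN : 0 <= A * sqnorm l g by rewrite mulr_ge0.
have aBN : 0 <= normc alpha ^+ 2 * (B * sqnorm l g) by rewrite mulr_ge0.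
split; first by lra.
have -> : w1 x = alpha * w x + v x by rewrite /v; ring.
apply: le_trans (sqr_normcD_le _ _) _.
rewrite Normc.normcM exprMn.
have := ler_wpM2l na0 bw; have := bv x xl; lra.
Qed.

End linear_ode.

(** * The boundary value problem *)

Section boundary_problem.
Variables (R : realType) (l : R) (theta : R[i]).
Hypothesis l0 : 0 < l.
Hypothesis theta1 : Normc.normc theta = 1.
Implicit Types (f g h u v w y : R -> R[i]) (x mu lam : R) (c : R[i]).
Local Notation C := R[i].
Local Notation normc := Normc.normc.
Local Notation dot := (L2dot l).
Local Notation psi0 := (psi_unnormalized l).

(* (L_0(theta) - mu) w = g, for w of class C^3 on the whole real line. *)
Definition shifted mu w g : Prop := exists w1 w2 w3,
  [/\ [/\ cder w w1, cder w1 w2, cder w2 w3 & ccont w3],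
      [/\ w 0 = 0, w1 l = theta * w1 0 & w l = 0] &
      forall x, g x = 'i%C * w3 x - mu%:C * w x].

Lemma shifted_ccont mu w g : shifted mu w g -> ccont w /\ ccont g.
Proof.
move=> [w1 [w2 [w3 [[dw dw1 dw2 cw3] _ gE]]]]; have cw := cder_ccont dw.
split=> //; rewrite (_ : g = fun x => 'i%C * w3 x - mu%:C * w x); last exact/funext.
by apply: ccontB; exact: ccontZ.
Qed.

(** Lagrange identity: the difference of the integrands is the derivative of [K], whose increment
    over [[0, l]] is a multiple of [1 - theta * theta^*], which is 0 as [theta] has modulus 1. *)
Lemma shifted_sym mu w g v h : shifted mu w g -> shifted mu v h ->
  dot g v = dot w h.
Proof.
move=> Aw Av; have [cw cg] := shifted_ccont Aw; have [cv ch] := shifted_ccont Av.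
case: Aw => w1 [w2 [w3 [[dw dw1 dw2 cw3] [w0 w1l wl] gE]]].
case: Av => v1 [v2 [v3 [[dv dv1 dv2 cv3] [v0 v1l vl] hE]]].
apply/eqP; rewrite -subr_eq0; apply/eqP.
have cgv := ccontM cg (ccontJ cv); have cwh := ccontM cw (ccontJ ch).
have := cintD l0 cgv (ccontN cwh).
have cN : cint l (fun x => - (w x * (h x)^*%C)) = - dot w h.
  have := cintZ l0 (-1) cwh; rewrite mulN1r => <-.
  by congr Cintegral; apply/funext => x; rewrite mulN1r.
rewrite cN => <-.
pose K x := 'i%C * (w2 x * (v x)^*%C - w1 x * (v1 x)^*%C + w x * (v2 x)^*%C).
have dK : cder K (fun x => g x * (v x)^*%C + - (w x * (h x)^*%C)).
  have d1 := cderM dw2 (cderJ dv); have d2 := cderM dw1 (cderJ dv1).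
  have d3 := cderM dw (cderJ dv2).
  apply: eq_cder (cderZ 'i%C (cderD (cderB d1 d2) d3)) => // x.
  by rewrite gE hE conjcB !conjcM conjci conjc_real; ring.
rewrite (cint_der l0 (ccontB cgv cwh) dK) /K w0 wl w1l v1l v0 vl.
rewrite conjcM.
rewrite conjc0.
transitivity ('i%C * w1 0 * (v1 0)^*%C * (1 - theta * theta^*%C)); first by ring.
by rewrite mulJ_normc theta1 expr1n subrr mulr0.
Qed.

Lemma shifted_lin mu c w g v h : shifted mu w g -> shifted mu v h ->
  shifted mu (fun x => w x + c * v x) (fun x => g x + c * h x).
Proof.
case=> w1 [w2 [w3 [[dw dw1 dw2 cw3] [w0 w1l wl] gE]]].
case=> v1 [v2 [v3 [[dv dv1 dv2 cv3] [v0 v1l vl] hE]]].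
exists (fun x => w1 x + c * v1 x), (fun x => w2 x + c * v2 x), (fun x => w3 x + c * v3 x).
split.
- split; do ?[by apply: cderD => //; exact: cderZ].
  by apply: ccontD => //; exact: ccontZ.
- by rewrite w0 v0 wl vl w1l v1l mulr0 addr0; split=> //; ring.
- by move=> x; rewrite gE hE; ring.
Qed.

Lemma shifted_shift mu nu w g : shifted mu w g ->
  shifted nu w (fun x => g x + (mu - nu)%:C * w x).
Proof.
case=> w1 [w2 [w3 [dd bc gE]]]; exists w1, w2, w3; split=> // x.
by rewrite gE rmorphB; ring.
Qed.

Lemma eq_shifted mu w g g' : g =1 g' -> shifted mu w g -> shifted mu w g'.
Proof. by move=> /funext->. Qed.

(** This turns [i y''' = lam^3 y] into [y''' = (i lam)^3 y]. *)
Lemma cube_i lam : ('i%C * lam%:C) ^+ 3 = - 'i%C * (lam ^+ 3)%:C.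
Proof.
transitivity (('i%C * 'i%C) * 'i%C * lam%:C ^+ 3); first by ring.
by rewrite mulii mulN1r rmorphXn.
Qed.

Lemma ccont_sq p lam : (p < 3)%N -> ccont (sq p lam%:C).
Proof.
case: p => [|[|[|]]] // _; [exact: cder_ccont (cder_sq0 _)|
  exact: cder_ccont (cder_sq1 _)|exact: cder_ccont (cder_sq2 _)].
Qed.

Definition psi1 lam x : C :=
  sq 1 lam%:C x * sq 1 lam%:C l - sq 0 lam%:C x * sq 2 lam%:C l.
Definition psi2 lam x : C :=
  sq 0 lam%:C x * sq 1 lam%:C l - ('i%C * lam%:C) ^+ 3 * sq 2 lam%:C x * sq 2 lam%:C l.

Lemma cder_psi0 lam : cder (psi0 lam) (psi1 lam).
Proof.
have := cderB (cderZ (sq 1 lam%:C l) (cder_sq2 lam%:C)) (cderZ (sq 2 lam%:C l) (cder_sq1 lam%:C)).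
by apply: eq_cder => x; rewrite /psi_unnormalized /psi1; ring.
Qed.

Lemma cder_psi1 lam : cder (psi1 lam) (psi2 lam).
Proof.
have := cderB (cderZ (sq 1 lam%:C l) (cder_sq1 lam%:C)) (cderZ (sq 2 lam%:C l) (cder_sq0 lam%:C)).
by apply: eq_cder => x; rewrite /psi1 /psi2; ring.
Qed.

Lemma cder_psi2 lam : cder (psi2 lam) (fun x => ('i%C * lam%:C) ^+ 3 * psi0 lam x).
Proof.
have := cderB (cderZ (sq 1 lam%:C l) (cder_sq0 lam%:C))
  (cderZ (('i%C * lam%:C) ^+ 3 * sq 2 lam%:C l) (cder_sq2 lam%:C)).
by apply: eq_cder => x; rewrite /psi2 /psi_unnormalized; ring.
Qed.

Lemma ccont_psi0 lam : ccont (psi0 lam).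
Proof. exact: cder_ccont (cder_psi0 lam). Qed.

Lemma psi0_0 lam : psi0 lam 0 = 0.
Proof. by rewrite /psi_unnormalized sq2_0 sq1_0; ring. Qed.

Lemma psi0_l lam : psi0 lam l = 0.
Proof. by rewrite /psi_unnormalized; ring. Qed.

Lemma psi1_0 lam : psi1 lam 0 = - sq 2 lam%:C l.
Proof. by rewrite /psi1 sq1_0 sq0_0; ring. Qed.

(** [sq_wronskian] trades the argument [- l] for [l]; thereby [Delta] is
    [theta * psi1 lam 0 - psi1 lam l], the defect of [psi0] in the condition
    [y'(l) = theta y'(0)]. *)
Lemma DeltaE lam : Delta l theta lam%:C =
  sq 0 lam%:C l * sq 2 lam%:C l - sq 1 lam%:C l ^+ 2 - theta * sq 2 lam%:C l.
Proof. by rewrite /Delta -sq_wronskian; ring. Qed.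

Lemma psi1_bc lam : real_zeros l theta lam -> psi1 lam l = theta * psi1 lam 0.
Proof.
rewrite /real_zeros /= DeltaE psi1_0 /psi1 => D0.
by apply/eqP; rewrite -subr_eq0 -oppr_eq0 -D0; apply/eqP; ring.
Qed.

Lemma shifted_psi0 lam : real_zeros l theta lam ->
  shifted (lam ^+ 3) (psi0 lam) (fun=> 0).
Proof.
move=> D0; exists (psi1 lam), (psi2 lam), (fun x => ('i%C * lam%:C) ^+ 3 * psi0 lam x).
split.
- split; [exact: cder_psi0|exact: cder_psi1|exact: cder_psi2|].
  exact/ccontZ/ccont_psi0.
- by split; [exact: psi0_0|exact: psi1_bc|exact: psi0_l].
- move=> x; rewrite cube_i.
  transitivity ((- ('i%C * 'i%C) - 1) * (lam ^+ 3)%:C * psi0 lam x); last by ring.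
  by rewrite mulii opprK subrr !mul0r.
Qed.

(** Vanishing on []0, l[] would force [psi1 lam 0 = 0] by continuity, but this value is
    [- sq 2 lam l], nonzero by [sq2_neq0]. So the normalization in [psi] never divides by 0. *)
Lemma psi0_norm_gt0 lam : 0 < sqnorm l (psi0 lam).
Proof.
rewrite lt_neqAle sqnorm_ge0 andbT eq_sym; apply/eqP => N0.
have p0 x : 0 < x < l -> psi0 lam x = 0 by exact: sqnorm_eq0 (ccont_psi0 lam) N0.
have p1 x : 0 < x < l -> psi1 lam x = 0 by exact: cder_eq0_itv (cder_psi0 lam) p0.
have := ccont_eq0_itv l0 (cder_ccont (cder_psi1 lam)) p1.
by rewrite psi1_0 => /eqP; rewrite oppr_eq0 (negbTE (sq2_neq0 lam l0)).
Qed.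

(** Write [w = u + a S1 + b S2] with [u] of zero initial data, hence controlled by [g]. The
    condition [w l = 0] eliminates [b] and leaves [w = r + c psi0] with [r] controlled. If [lam] is
    a zero, orthogonality disposes of [c psi0]; otherwise the condition on [w'] determines [a],
    after division by [Delta]. *)
Lemma gap lam : exists2 K, 0 <= K & forall w g, shifted (lam ^+ 3) w g ->
  (real_zeros l theta lam -> dot w (psi0 lam) = 0) -> sqnorm l w <= K * sqnorm l g.
Proof.
have [K K0 bound] := order3_bound l0 ('i%C * lam%:C).
set S0 := sq 0 lam%:C; set S1 := sq 1 lam%:C; set S2 := sq 2 lam%:C.
have cS2 : ccont S2 by exact: ccont_sq.
have S2l : S2 l != 0 := sq2_neq0 lam l0.
pose q := normc (S2 l) ^- 2.
have q0 : 0 <= q by rewrite invr_ge0 sqr_ge0.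
pose K1 := 2 * (l * K) + 2 * (q * K * sqnorm l S2).
pose D := Delta l theta lam%:C.
(* [K2] is meant for [D <> 0]; if [D = 0], its inverse is 0 by convention and only [0 <= K2] is
   used. *)
pose K2 := 2 * (normc D ^- 2 * q * sqnorm l (psi0 lam) *
   (2 * normc (S1 l) ^+ 2 * K + 2 * normc (S2 l) ^+ 2 * K)) + 2 * K1.
have NS2 := sqnorm_ge0 l S2; have Np := sqnorm_ge0 l (psi0 lam).
have L0 := ltW l0.
have K10 : 0 <= K1 by rewrite addr_ge0// mulr_ge0// ?mulr_ge0.
have K20 : 0 <= K2.
  rewrite addr_ge0// mulr_ge0// !mulr_ge0// ?invr_ge0 ?sqr_ge0//.
  by rewrite addr_ge0// mulr_ge0// mulr_ge0// sqr_ge0.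
exists (K1 + K2); first exact: addr_ge0.
move=> w g Aw; have [cw cg] := shifted_ccont Aw.
case: Aw => w1 [w2 [w3 [[dw dw1 dw2 cw3] [w0 w1l wl] gE]]] orth.
have Ng := sqnorm_ge0 l g.
pose a := w1 0; pose b := w2 0; pose al := 'i%C * lam%:C.
pose u x := w x - (a * S1 x + b * S2 x).
pose u1 x := w1 x - (a * S0 x + b * S1 x).
pose u2 x := w2 x - (a * (al ^+ 3 * S2 x) + b * S0 x).
pose u3 x := w3 x - (a * (al ^+ 3 * S1 x) + b * (al ^+ 3 * S2 x)).
have du : cder u u1.
  by apply: cderB => //; apply: cderD; apply: cderZ; [exact: cder_sq1|exact: cder_sq2].
have du1 : cder u1 u2.
  by apply: cderB => //; apply: cderD; apply: cderZ; [exact: cder_sq0|exact: cder_sq1].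
have du2 : cder u2 u3.
  apply: cderB => //; apply: cderD; apply: cderZ; [|exact: cder_sq0].
  by apply: cderZ; exact: cder_sq2.
have cu := cder_ccont du.
have NG : sqnorm l (fun x => - 'i%C * g x) = sqnorm l g.
  by rewrite sqnormZ// sqr_normcE !ReImE /=; ring.
have u3E x : u3 x = al ^+ 3 * u x + - 'i%C * g x.
  rewrite gE /u3 /u; transitivity (al ^+ 3 * (w x - (a * S1 x + b * S2 x)) + (w3 x - al ^+ 3 * w x)).
    by ring.
  rewrite /al cube_i; congr +%R.
  transitivity (- ('i%C * 'i%C) * w3 x + 'i%C * (lam ^+ 3)%:C * w x); last by ring.
  by rewrite mulii opprK mul1r; ring.
have u00 : u 0 = 0 by rewrite /u w0 /S1 /S2 sq1_0 sq2_0; ring.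
have u10 : u1 0 = 0 by rewrite /u1 /S0 /S1 sq1_0 sq0_0 /a; ring.
have u20 : u2 0 = 0 by rewrite /u2 /S0 /S2 sq2_0 sq0_0 /b; ring.
have bnd := bound _ _ _ _ _ (ccontZ (- 'i%C) cg) du du1 du2 u3E u00 u10 u20.
rewrite NG in bnd.
have ll : 0 <= l <= l by rewrite lexx ltW.
have [bul bu1l] := bnd l ll.
have KN : 0 <= K * sqnorm l g by rewrite mulr_ge0.
pose k := u l / S2 l.
pose r x := u x - k * S2 x.
have cr : ccont r by apply: ccontB => //; exact: ccontZ.
have Nr : sqnorm l r <= K1 * sqnorm l g.
  apply: le_trans (sqnormB_le l0 cu (ccontZ k cS2)) _.
  have Nu : sqnorm l u <= l * (K * sqnorm l g).
    by apply: (sqnorm_sup_le l0) => // y /andP[y0 yl]; apply: (bnd y _).1; rewrite !ltW.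
  have kE : normc k ^+ 2 <= q * (K * sqnorm l g).
    by rewrite /k Normc.normcM Normc.normcV exprMn exprVn mulrC ler_wpM2l.
  rewrite sqnormZ//; have := ler_wpM2r NS2 kE; rewrite /K1; lra.
pose c := - (a / S2 l).
have wE x : w x = r x + c * psi0 lam x.
  have bE : b = - (u l + a * S1 l) / S2 l.
    by rewrite /u wl; field.
  have uE : u x = w x - (a * S1 x + b * S2 x) by [].
  rewrite /r /k /c /psi_unnormalized -/S1 -/S2 uE bE.
  by move: (u l) (w x) (S1 x) (S2 x) => ? ? ? ?; field.
have [Z|nZ] := pselect (real_zeros l theta lam).
  (* Pythagoras: w is orthogonal to psi, hence no longer than r = w - c psi *)
  have cp := ccont_psi0 lam.
  have rE : r = fun x => w x - c * psi0 lam x.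
    by apply/funext => x; rewrite wE; ring.
  have : sqnorm l w <= sqnorm l r.
    rewrite rE sqnormB//; last exact: ccontZ.
    rewrite dotZr// (orth Z) mulr0 /= mulr0 subr0 lerDl; exact: sqnorm_ge0.
  move=> /le_trans; apply; apply: le_trans Nr _.
  by rewrite ler_wpM2r// lerDl.
(* [b] is eliminated between the two boundary conditions at [l]; what remains multiplies [a] by
   [Delta]. *)
have aD : a * D = u l * S1 l - u1 l * S2 l.
  rewrite /D DeltaE -/S0 -/S1 -/S2 /u /u1 wl w1l -/a; ring.
have D0 : D != 0 by apply/eqP.
have aE : normc a ^+ 2 <= normc D ^- 2 * (2 * normc (S1 l) ^+ 2 * K + 2 * normc (S2 l) ^+ 2 * K) * sqnorm l g.
  have -> : a = D^-1 * (u l * S1 l - u1 l * S2 l) by rewrite -aD mulrCA mulVf ?mulr1.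
  rewrite Normc.normcM exprMn Normc.normcV exprVn -mulrA ler_wpM2l ?invr_ge0 ?sqr_ge0//.
  apply: le_trans (sqr_normcD_le _ _) _.
  rewrite normcN !Normc.normcM !exprMn.
  have := ler_wpM2r (sqr_ge0 (normc (S1 l))) bul.
  have := ler_wpM2r (sqr_ge0 (normc (S2 l))) bu1l.
  lra.
have -> : sqnorm l w = sqnorm l (fun x => r x + c * psi0 lam x) by congr (sqnorm l); apply/funext.
apply: le_trans (sqnormD_le l0 cr (ccontZ c (ccont_psi0 lam))) _.
rewrite sqnormZ//; last exact: ccont_psi0.
have -> : normc c ^+ 2 = q * normc a ^+ 2.
  by rewrite /c normcN Normc.normcM Normc.normcV exprMn exprVn mulrC.
have aNE := ler_wpM2r Np (ler_wpM2l q0 aE).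
have KNg : 0 <= K1 * sqnorm l g by rewrite mulr_ge0.
have -> : (K1 + K2) * sqnorm l g = K1 * sqnorm l g + (2 * (K1 * sqnorm l g) +
    2 * (q * (normc D ^- 2 * (2 * normc (S1 l) ^+ 2 * K + 2 * normc (S2 l) ^+ 2 * K) *
      sqnorm l g) * sqnorm l (psi0 lam))) by rewrite /K2; ring.
by rewrite ler_wpDl// lerD// ler_wpM2l.
Qed.

(** The decomposition in [gap] read backwards: from the solution [u] with zero initial data, [a] and
    [b] are chosen to meet the two conditions at [l], which is possible because [Delta] and [S2 l]
    are nonzero. *)
Lemma resolvent lam g : ~ real_zeros l theta lam -> ccont g ->
  exists w, shifted (lam ^+ 3) w g.
Proof.
move=> nZ cg.
have [u [u1 [u2 [u3 [du du1 du2 u3E [u0 u10 u20]]]]]] :=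
  order3_solution ('i%C * lam%:C) (ccontZ (- 'i%C) cg).
set S0 := sq 0 lam%:C; set S1 := sq 1 lam%:C; set S2 := sq 2 lam%:C.
have S2l : S2 l != 0 := sq2_neq0 lam l0.
pose D := Delta l theta lam%:C.
have D0 : D != 0 by apply/eqP.
have DE : D = S0 l * S2 l - S1 l ^+ 2 - theta * S2 l by exact: DeltaE.
pose al := 'i%C * lam%:C.
pose a := (u l * S1 l - u1 l * S2 l) / D.
pose b := - (u l + a * S1 l) / S2 l.
pose w x := u x + (a * S1 x + b * S2 x).
pose w1 x := u1 x + (a * S0 x + b * S1 x).
pose w2 x := u2 x + (a * (al ^+ 3 * S2 x) + b * S0 x).
pose w3 x := u3 x + (a * (al ^+ 3 * S1 x) + b * (al ^+ 3 * S2 x)).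
have cu3 : ccont u3.
  rewrite (_ : u3 = fun x => al ^+ 3 * u x + - 'i%C * g x); last exact/funext.
  by apply: ccontD; apply: ccontZ => //; exact: cder_ccont du.
exists w, w1, w2, w3; split.
- split.
  + by apply: cderD => //; apply: cderD; apply: cderZ; [exact: cder_sq1|exact: cder_sq2].
  + by apply: cderD => //; apply: cderD; apply: cderZ; [exact: cder_sq0|exact: cder_sq1].
  + apply: cderD => //; apply: cderD; apply: cderZ; [|exact: cder_sq0].
    by apply: cderZ; exact: cder_sq2.
  + by apply: ccontD => //; apply: ccontD; do 2![apply: ccontZ]; exact: ccont_sq.
- split.
  + by rewrite /w u0 /S1 /S2 sq1_0 sq2_0; ring.
  + have aD : a * D = u l * S1 l - u1 l * S2 l by rewrite /a divfK.
    have bS : b * S2 l = - (u l + a * S1 l) by rewrite /b divfK.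
    (* Multiplying by [S2 l] clears the denominator of [b]. *)
    apply/eqP; rewrite -subr_eq0 -(mulIr_eq0 _ (mulIf S2l)); apply/eqP.
    rewrite /w1 u10 {2}/S0 {2}/S1 sq0_0 sq1_0.
    transitivity (a * (S0 l * S2 l - theta * S2 l) + u1 l * S2 l + b * S2 l * S1 l); first by ring.
    rewrite bS; transitivity (a * (S0 l * S2 l - S1 l ^+ 2 - theta * S2 l) - (u l * S1 l - u1 l * S2 l)).
      by ring.
    by rewrite -DE aD subrr.
  + by rewrite /w /b; field.
- move=> x; rewrite /w3 /w u3E -/al.
  transitivity (g x + ('i%C * al ^+ 3 - (lam ^+ 3)%:C) * (u x + (a * S1 x + b * S2 x))).
    rewrite /al cube_i (_ : 'i%C * (- 'i%C * (lam ^+ 3)%:C) = (lam ^+ 3)%:C); last first.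
      by rewrite mulNr mulrN mulrA mulii mulN1r opprK.
    by rewrite subrr mul0r addr0.
  transitivity (- ('i%C * 'i%C) * g x + ('i%C * al ^+ 3 - (lam ^+ 3)%:C) * (u x + (a * S1 x + b * S2 x))).
    by rewrite mulii opprK mul1r.
  by ring.
Qed.

End boundary_problem.

(** * Eigenvalues *)

Section spectrum.
Variables (R : realType) (l : R) (theta : R[i]).
Hypothesis l0 : 0 < l.
Hypothesis theta1 : Normc.normc theta = 1.
Implicit Types (f g h u v w y z : R -> R[i]) (x mu lam : R) (c : R[i]).
Local Notation C := R[i].
Local Notation normc := Normc.normc.
Local Notation dot := (L2dot l).
Local Notation psi0 := (psi_unnormalized l).
Local Notation e := (psi l).
Local Notation Z := (real_zeros l theta).
Local Notation shifted := (shifted l theta).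

(** Distinct zeros thus have distinct eigenvalues [lam ^+ 3]. The cofactor of [a - b] in [a^3 - b^3]
    is written as a sum of squares. *)
Lemma cube_inj : injective (fun x : R => x ^+ 3).
Proof.
move=> a b /= ab; apply/eqP; rewrite -subr_eq0.
have : (a - b) * ((a + b / 2) ^+ 2 + 3 / 4 * b ^+ 2) = 0.
  by transitivity (a ^+ 3 - b ^+ 3); [field|rewrite ab subrr].
move=> /eqP; rewrite mulf_eq0 => /orP[//|/eqP s0].
have h1 := sqr_ge0 (a + b / 2); have h2 := sqr_ge0 b.
have /eqP b2 : b ^+ 2 = 0 by lra.
have /eqP a2 : (a + b / 2) ^+ 2 = 0 by lra.
move: b2 a2; rewrite !sqrf_eq0 => /eqP->.
by rewrite mul0r addr0 subr0.
Qed.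

(** [gap] is stated at cubes; this makes it available at every real spectral parameter. *)
Lemma cube_root (m : R) : exists lam, lam ^+ 3 = m.
Proof.
have pos (a : R) : 0 <= a -> exists lam, lam ^+ 3 = a.
  move=> a0; exists (a `^ 3^-1).
  by rewrite -powR_mulrn ?powR_ge0// -powRrM mulVf ?pnatr_eq0// powRr1.
have [/pos//|/ltW m0] := leP 0 m.
have [|lam lamE] := pos (- m); first by rewrite oppr_ge0.
by exists (- lam); rewrite exprNn lamE; ring.
Qed.

Lemma psiE lam : e lam = fun x => ((Num.sqrt (sqnorm l (psi0 lam)))%:C)^-1 * psi0 lam x.
Proof. by []. Qed.

Lemma ccont_psi lam : ccont (e lam).
Proof. exact/ccontZ/ccont_psi0. Qed.

Lemma sqnorm_psi lam : sqnorm l (e lam) = 1.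
Proof.
have N0 := psi0_norm_gt0 l0 lam.
rewrite psiE sqnormZ//; last exact: ccont_psi0.
rewrite Normc.normcV exprVn sqr_normcE /= expr0n addr0 sqr_sqrtr ?ltW//.
by rewrite mulVf// gt_eqF.
Qed.

Lemma shifted0 mu : shifted mu (fun=> 0) (fun=> 0).
Proof.
exists (fun=> 0), (fun=> 0), (fun=> 0); split.
- by split; do ?[exact: cder_cst]; exact: ccont_cst.
- by rewrite mulr0.
- by move=> x; rewrite !mulr0 subr0.
Qed.

Lemma shiftedZ mu c w g : shifted mu w g ->
  shifted mu (fun x => c * w x) (fun x => c * g x).
Proof.
move=> /(shifted_lin c (shifted0 mu)).
by under eq_fun do rewrite add0r; under [in X in shifted _ _ X]eq_fun do rewrite add0r.
Qed.

Lemma shifted_psi lam mu : Z lam ->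
  shifted mu (e lam) (fun x => (lam ^+ 3 - mu)%:C * e lam x).
Proof.
move=> /shifted_psi0/(shiftedZ ((Num.sqrt (sqnorm l (psi0 lam)))%:C)^-1)/(shifted_shift mu).
by apply: eq_shifted => x; rewrite mulr0 add0r.
Qed.

Lemma realC_eq0 (a : R) : (a%:C == 0 :> C) = (a == 0).
Proof. by apply/eqP/eqP => [/complexI|->]. Qed.

Lemma dot_shifted_psi mu lam w g : shifted mu w g -> Z lam ->
  dot g (e lam) = (lam ^+ 3 - mu)%:C * dot w (e lam).
Proof.
move=> Aw Zl; have [cw cg] := shifted_ccont Aw.
by rewrite (shifted_sym l0 theta1 Aw (shifted_psi mu Zl)) dotZr ?conjc_real//; exact: ccont_psi.
Qed.

(** Symmetry at [mu = lam ^+ 3] gives [0 = (lam'^3 - lam^3)] times the product, and cubes are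
    injective. *)
Lemma dot_psi lam lam' : Z lam -> Z lam' -> dot (e lam) (e lam') = (lam == lam')%:R.
Proof.
move=> Zl Zl'; case: eqVneq => [->|neq]; first by rewrite dotE sqnorm_psi.
have := dot_shifted_psi (shifted_psi (lam ^+ 3) Zl) Zl'.
rewrite subrr dotZl ?mul0r//; try exact: ccont_psi.
move=> /esym/eqP; rewrite mulf_eq0 realC_eq0 subr_eq0 => /orP[/eqP/cube_inj E|/eqP//].
by rewrite E eqxx in neq.
Qed.

Lemma gap_psi lam : exists2 K, 0 <= K & forall w g, shifted (lam ^+ 3) w g ->
  (Z lam -> dot w (e lam) = 0) -> sqnorm l w <= K * sqnorm l g.
Proof.
have [K K0 KP] := gap theta l0 lam; exists K => // w g Aw orth.
apply: (KP _ _ Aw) => /orth; have [cw _] := shifted_ccont Aw.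
rewrite psiE dotZr//; last exact: ccont_psi0.
move=> /eqP; rewrite mulf_eq0 => /orP[|/eqP//].
rewrite complex_real_inv conjc_real realC_eq0 invr_eq0 sqrtr_eq0 leNgt.
by rewrite (psi0_norm_gt0 l0 lam).
Qed.

(** The gap estimate at [lam] is applied to the unit eigenfunction at [lam']. Here [lam] is any real
    number, zero of [Delta] or not. *)
Lemma zeros_isolated lam : exists2 K, 0 <= K & forall lam', Z lam' -> lam' != lam ->
  1 <= K * (lam' ^+ 3 - lam ^+ 3) ^+ 2.
Proof.
have [K K0 KP] := gap_psi lam; exists K => // lam' Zl' neq.
have := KP _ _ (shifted_psi (lam ^+ 3) Zl').
rewrite sqnormZ//; last exact: ccont_psi.
rewrite sqnorm_psi mulr1 sqr_normcE /= expr0n addr0; apply => Zl.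
by rewrite dot_psi// (negbTE neq).
Qed.

(** If 0 is a zero, every other zero satisfies [1 <= K * lam^6], which fails at [(K + 1)^-1]. *)
Lemma exists_nonzero : exists lam, ~ Z lam.
Proof.
have [Z0|] := pselect (Z 0); last by exists 0.
have [K K0 KP] := zeros_isolated 0.
have K1 : 0 < K + 1 by rewrite ltr_wpDl.
exists (K + 1)^-1 => /KP; rewrite invr_eq0 gt_eqF// => /(_ isT).
rewrite expr0n subr0 leNgt => /negP; apply.
rewrite -exprM exprVn -[X in _ < X](mulfV (lt0r_neq0 (exprn_gt0 6 K1))).
rewrite ltr_pM2r ?invr_gt0 ?exprn_gt0//.
apply: (@lt_le_trans _ _ (K + 1)); first by rewrite ltrDl.
by rewrite ler_eXnr// lerDr.
Qed.

(** Bolzano-Weierstrass: infinitely many zeros in a bounded set would accumulate at some [p],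
    against [zeros_isolated p]. *)
Lemma finite_zeros mu (M : R) :
  exists s : seq R, uniq s /\ forall lam, (lam \in s) <-> (Z lam /\ `|lam ^+ 3 - mu| <= M).
Proof.
pose E := [set lam | Z lam /\ `|lam ^+ 3 - mu| <= M].
suff /finite_seqP[s sE] : finite_set E.
  exists (undup s); split; first exact: undup_uniq.
  by move=> lam; rewrite mem_undup; have -> : (lam \in s) = ([set` s] lam) :> Prop by []; rewrite -sE.
apply: contrapT => infE.
have [|p pE] := infinite_bounded_limit_point_nonempty infE.
  (* The cube of [|lam|] is at most [|mu| + M], and [|lam|] is at most 1 or at most its cube. *)
  exists (`|mu| + M + 1); split; first exact: num_real.
  move=> B /ltW MB lam /= [_ lamM]; apply: le_trans MB.
  have : `|lam| ^+ 3 <= `|mu| + M.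
    rewrite -normrX -[lam ^+ 3](subrK mu) (le_trans (ler_normD _ _))//.
    by rewrite addrC lerD2l.
  set a := `|lam| => aM; have a0 : 0 <= a by exact: normr_ge0.
  have [a1|/ltW a1] := leP a 1.
    rewrite (le_trans a1)// lerDr (le_trans _ aM)// exprn_ge0//.
  apply: le_trans (ler_eXnr _ a1) (le_trans aM _) => //.
  by rewrite lerDl.
have [K K0 KP] := zeros_isolated p.
pose U := [set x | K * (x ^+ 3 - p ^+ 3) ^+ 2 < 1].
have nU : nbhs p U.
  have cp : K * (x ^+ 3 - p ^+ 3) ^+ 2 @[x --> p] --> K * (p ^+ 3 - p ^+ 3) ^+ 2.
    apply: cvgM; first exact: cvg_cst.
    apply: (@cvgM _ _ _ _ (fun x => x ^+ 3 - p ^+ 3) (fun x => x ^+ 3 - p ^+ 3));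
    by apply: cvgB; [exact: exprn_continuous|exact: cvg_cst].
  rewrite subrr expr0n mulr0 in cp.
  exact: (cvgr_lt _ cp).
have [lam [neq [Zl _] Ul]] := pE _ nU.
by have := KP _ Zl neq; rewrite leNgt => /negP.
Qed.

End spectrum.

(** * Expansion in eigenfunctions *)

Section expansion.
Variables (R : realType) (l : R) (theta : R[i]).
Hypothesis l0 : 0 < l.
Hypothesis theta1 : Normc.normc theta = 1.
Implicit Types (f g h u v w y z : R -> R[i]) (x mu lam : R) (c : R[i]).
Local Notation C := R[i].
Local Notation Re := complex.Re.
Local Notation normc := Normc.normc.
Local Notation dot := (L2dot l).
Local Notation e := (psi l).
Local Notation Z := (real_zeros l theta).
Local Notation shifted := (shifted l theta).

Variables (lam0 eps : R) (s : seq R).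
Let mu0 := lam0 ^+ 3.
Hypothesis nZ : ~ Z lam0.
Hypothesis eps0 : 0 < eps.
Hypothesis us : uniq s.
Hypothesis sP : forall lam, (lam \in s) <-> (Z lam /\ `|lam ^+ 3 - mu0| <= eps^-1).

(** With [K = (L_0 - mu0)^-1], [shifted mu0 w u] reads [w = K u]. The list [s] holds the zeros whose
    eigenvalue [1 / (lam^3 - mu0)] under [K] has modulus at least [eps]; [perp] is the orthogonal
    complement of their eigenfunctions. *)
Definition perp u := forall lam, lam \in s -> dot u (e lam) = 0.

Lemma zero_neq lam : Z lam -> lam ^+ 3 - mu0 != 0.
Proof.
by move=> Zl; rewrite subr_eq0; apply/eqP => /cube_inj E; apply: nZ; rewrite -E.
Qed.

Lemma perp_inverse w u : shifted mu0 w u -> perp u -> perp w.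
Proof.
move=> Aw pu lam ls; have [Zl _] := (sP lam).1 ls.
have := dot_shifted_psi l0 theta1 Aw Zl; rewrite pu// => /esym/eqP.
by rewrite mulf_eq0 realC_eq0 (negbTE (zero_neq Zl)) => /eqP.
Qed.

Lemma ccont_shifted w u : shifted mu0 w u -> ccont w * ccont u.
Proof. by move=> /shifted_ccont[]. Qed.

Lemma sqnorm_realZ (a : R) f : ccont f -> sqnorm l (fun x => a%:C * f x) = a ^+ 2 * sqnorm l f.
Proof. by move=> cf; rewrite sqnormZ// sqr_normcE /= expr0n addr0. Qed.

(* sigma outside [-eps, eps] is in the resolvent set of (L_0 - mu0)^-1
   restricted to the orthogonal complement of the e lam, lam \in s *)
Lemma inverse_gap (sigma : R) : eps < `|sigma| -> exists2 k, 0 <= k &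
  forall y z, shifted mu0 y z -> perp z ->
  sqnorm l z <= k * sqnorm l (fun x => y x - sigma%:C * z x).
Proof.
move=> es; have s0 : sigma != 0 by rewrite -normr_gt0 (lt_trans eps0).
(* For [z = (L_0 - mu0) y], one has [y - sigma z = - sigma (L_0 - mu0 - 1/sigma) y], so the gap
   estimate is needed at [mu0 + 1/sigma]. *)
have [lam lamE] := cube_root (mu0 + sigma^-1).
have [K K0 KP] := gap_psi theta l0 lam.
have s2 : 0 < sigma ^+ 2 by rewrite exprn_even_gt0// s0 orbT.
exists ((2 * K * (sigma^-1) ^+ 2 + 2) * (sigma^-1) ^+ 2).
  have si := sqr_ge0 sigma^-1.
  by apply: mulr_ge0 => //; apply: addr_ge0 => //; do 2![apply: mulr_ge0 => //].
move=> y z Ay pz; have [cy cz] := ccont_shifted Ay.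
have cd := ccontB cy (ccontZ sigma%:C cz).
have N1 : sqnorm l y <= K * ((sigma^-1) ^+ 2 * sqnorm l (fun x => y x - sigma%:C * z x)).
  rewrite -sqrrN -sqnorm_realZ//; apply: KP => [|Zl].
    apply: eq_shifted (shifted_shift _ Ay) => x; rewrite lamE.
    have -> : mu0 - (mu0 + sigma^-1) = - sigma^-1 by ring.
    have sC : (- sigma^-1)%:C * sigma%:C = -1 :> C.
      by rewrite -realCM mulNr mulVf// rmorphN.
    by rewrite mulrBr mulrA sC; ring.
  (* If [lam] is a zero, its distance [1/|sigma| < 1/eps] from [mu0] puts it in [s], so [y] is
     orthogonal to its eigenfunction. *)
  apply: (perp_inverse Ay pz); apply/sP; split=> //.
  rewrite lamE addrAC subrr add0r normrV ?unitfE// lef_pV2 ?ltW//.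
    by rewrite posrE normr_gt0.
have zE : z = fun x => (sigma^-1)%:C * (y x - (y x - sigma%:C * z x)).
  apply/funext => x; rewrite opprB addrCA subrr addr0 mulrA -realCM mulVf//.
  by rewrite mul1r.
have -> : sqnorm l z = (sigma^-1) ^+ 2 * sqnorm l (fun x => y x - (y x - sigma%:C * z x)).
  by rewrite {1}zE sqnorm_realZ//; exact: ccontB.
rewrite -mulrA [X in _ <= X]mulrCA ler_wpM2l ?sqr_ge0//.
apply: le_trans (sqnormB_le l0 cy cd) _.
set d := sqnorm l (fun x => y x - sigma%:C * z x); rewrite -/d in N1.
have -> : (2 * K * sigma^-1 ^+ 2 + 2) * d = 2 * (K * (sigma^-1 ^+ 2 * d)) + 2 * d by ring.
by rewrite lerD2r ler_wpM2l.
Qed.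

(** By contradiction: let [r = rho^2 > eps^2] be the supremum of the quotients of squared norms of
    [K u] and [u] on the complement. [inverse_gap] at [rho] and [- rho] bounds
    [K^2 - r = (K - rho)(K + rho)] from below, while almost maximizing vectors make it small. *)
Lemma inverse_norm_le w u : shifted mu0 w u -> perp u -> sqnorm l w <= eps ^+ 2 * sqnorm l u.
Proof.
move=> Aw0 pu0; rewrite leNgt; apply/negP => wu.
have [K0 K00 K0P] := gap_psi theta l0 lam0.
have bnd w' u' : shifted mu0 w' u' -> sqnorm l w' <= K0 * sqnorm l u' by move=> /K0P; apply.
pose E := [set q : R | exists w u,
  [/\ shifted mu0 w u, perp u, 0 < sqnorm l u & sqnorm l w = q * sqnorm l u]].
have u0 : 0 < sqnorm l u.
  rewrite lt_neqAle sqnorm_ge0 andbT eq_sym; apply/eqP => Nu.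
  by have := bnd _ _ Aw0; rewrite Nu mulr0 leNgt; move: wu; rewrite Nu mulr0 => ->.
have Eq : E (sqnorm l w / sqnorm l u) by exists w, u; split=> //; rewrite divfK// gt_eqF.
have supE : has_sup E.
  split; first by exists (sqnorm l w / sqnorm l u).
  exists K0 => q [w' [u' [A' p' n' qE]]].
  by rewrite -(ler_pM2r n') -qE bnd.
pose r := sup E.
have rP w' u' : shifted mu0 w' u' -> perp u' -> sqnorm l w' <= r * sqnorm l u'.
  move=> A' p'; have [n'|n'] := ltP 0 (sqnorm l u').
    rewrite -ler_pdivrMr//; apply: sup_upper_bound => //.
    by exists w', u'; split=> //; rewrite divfK// gt_eqF.
  have n0 : sqnorm l u' = 0 by apply/eqP; rewrite eq_le n' sqnorm_ge0.
  by have := bnd _ _ A'; rewrite n0 !mulr0.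
have re : eps ^+ 2 < r.
  have qr : sqnorm l w / sqnorm l u <= r by exact: sup_upper_bound.
  by apply: lt_le_trans qr; rewrite ltr_pdivlMr.
have r0 : 0 < r by apply: lt_trans re; rewrite exprn_gt0.
pose rho := Num.sqrt r.
have rho2 : rho ^+ 2 = r by rewrite sqr_sqrtr// ltW.
have rho0 : 0 < rho by rewrite sqrtr_gt0.
have erho : eps < rho by rewrite -(ltr_pXn2r (n := 2))// ?nnegrE ?ltW// rho2.
have ep : eps < `|rho| by rewrite gtr0_norm.
have em : eps < `|- rho| by rewrite normrN.
have [kp kp0 kpP] := inverse_gap ep.
have [km km0 kmP] := inverse_gap em.
(* With [M = km * kp * r], the tolerance [1 / (M + 1)] will give
   [sqnorm u' <= M / (M + 1) * sqnorm u'], impossible for [u'] nonzero. *)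
have [q [w' [u' [A' p' n' qE]]] qr] : exists2 q, E q & sup E - (km * kp * r + 1)^-1 < q.
  apply: sup_adherent => //; rewrite invr_gt0 ltr_wpDl// !mulr_ge0//; exact: ltW.
rewrite -/r in qr.
have [cw' cu'] := ccont_shifted A'.
have [w2 A2] := resolvent l0 nZ cw'; rewrite -/mu0 in A2.
have [c2 _] := ccont_shifted A2.
have p2 := perp_inverse A' p'.
(* With [w' = K u'] and [w2 = K^2 u'], the estimate at [- rho] is applied to [u'] and the one at
   [rho] to [(K + rho) u']. *)
have Az : shifted mu0 (fun x => w2 x + rho%:C * w' x) (fun x => w' x + rho%:C * u' x).
  exact: shifted_lin.
have pz : perp (fun x => w' x + rho%:C * u' x).
  move=> lam ls; have ce := ccont_psi l lam.
  rewrite dotDl//; last exact: ccontZ.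
  by rewrite dotZl// p2// p'// mulr0 addr0.
have h1 := kmP _ _ A' p'.
have h2 := kpP _ _ Az pz.
have E1 : (fun x => w' x - (- rho)%:C * u' x) = (fun x => w' x + rho%:C * u' x).
  by apply/funext => x; rewrite rmorphN mulNr opprK.
have E2 : (fun x => w2 x + rho%:C * w' x - rho%:C * (w' x + rho%:C * u' x)) =
          (fun x => w2 x - r%:C * u' x).
  apply/funext => x; rewrite -rho2 rmorphXn; ring.
rewrite E1 in h1; rewrite E2 in h2.
have D2 : Re (dot w2 (fun x => r%:C * u' x)) = r * sqnorm l w'.
  rewrite dotZr// conjc_real -(shifted_sym l0 theta1 A2 A') dotE -realCM.
  by [].
(* The square is expanded: the cross term is [- 2 r] times the squared norm of [w'] by symmetry of
   [K], and that of [w2 = K w'] is at most [r] times that of [w']. *)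
have h3 : sqnorm l (fun x => w2 x - r%:C * u' x) <= r * (r * sqnorm l u' - sqnorm l w').
  rewrite sqnormB//; last exact: ccontZ.
  rewrite D2 sqnorm_realZ//.
  have := rP _ _ A2 p2; set a := sqnorm l w'; set b := sqnorm l u'; move: a b => a b ab.
  rewrite -subr_ge0.
  have -> : r * (r * b - a) - (sqnorm l w2 + r ^+ 2 * b - 2 * (r * a)) = r * a - sqnorm l w2 by ring.
  by rewrite subr_ge0.
have h4 : r * sqnorm l u' - sqnorm l w' < (km * kp * r + 1)^-1 * sqnorm l u'.
  by rewrite qE -mulrBl ltr_pM2r//; lra.
have h5 : sqnorm l u' <= km * kp * r * (r * sqnorm l u' - sqnorm l w').
  apply: le_trans h1 _; rewrite -!mulrA ler_wpM2l//.
  by apply: le_trans h2 _; rewrite ler_wpM2l.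
set M := km * kp * r in h4 h5.
have M0 : 0 <= M by rewrite !mulr_ge0// ltW.
have M1 : 0 < M + 1 by rewrite ltr_wpDl.
have : sqnorm l u' <= M * ((M + 1)^-1 * sqnorm l u').
  by apply: le_trans h5 _; rewrite ler_wpM2l// ltW.
rewrite mulrA -subr_ge0 -{2}[sqnorm l u']mul1r -mulrBl pmulr_lge0//.
have -> : M / (M + 1) - 1 = - (M + 1)^-1 by field; rewrite gt_eqF.
by rewrite oppr_ge0 leNgt invr_gt0 M1.
Qed.

(** Here [g = K h]. If [S] is the projection of [h] on the eigenfunctions of [s], then [K S] is the
    sum with coefficients [c], and the remainder [K (h - S)] falls under [inverse_norm_le]. *)
Lemma expansion_approx g h : shifted mu0 g h ->
  exists c : R -> C, sqnorm l (fun x => g x - \sum_(lam <- s) c lam * e lam x) <= eps ^+ 2 * sqnorm l h.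
Proof.
move=> Ag; have [cg ch] := ccont_shifted Ag.
pose d lam := dot h (e lam).
pose S x := \sum_(lam <- s) d lam * e lam x.
pose c lam := (lam ^+ 3 - mu0)%:C^-1 * d lam.
have sZ lam : lam \in s -> Z lam by move=> /sP[].
have cS : ccont S by apply: ccont_sum => lam; exact/ccontZ/ccont_psi.
exists c.
have Aw : shifted mu0 (fun x => g x - \sum_(lam <- s) c lam * e lam x) (fun x => h x - S x).
  have : forall t : seq R, {subset t <= s} -> shifted mu0 (fun x => \sum_(lam <- t) c lam * e lam x)
     (fun x => \sum_(lam <- t) d lam * e lam x).
    elim=> [_|lam t ih ts].
      have E0 (k : R -> C) : (fun x => \sum_(lam <- [::]) k lam * e lam x) = fun=> 0.
        by apply/funext => x; rewrite big_nil.
      by rewrite !E0; exact: shifted0.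
    have lt_s : lam \in s by apply: ts; rewrite inE eqxx.
    have tt : {subset t <= s} by move=> x xt; apply: ts; rewrite inE xt orbT.
    have c0 : (lam ^+ 3 - mu0)%:C != 0 :> C by rewrite realC_eq0; exact: zero_neq (sZ _ lt_s).
    have := shifted_lin 1 (shiftedZ (c lam) (shifted_psi mu0 (sZ _ lt_s))) (ih tt).
    have -> : (fun x => c lam * e lam x + 1 * \sum_(lam <- t) c lam * e lam x) =
              (fun x => \sum_(lam <- lam :: t) c lam * e lam x).
      by apply/funext => x; rewrite big_cons mul1r.
    apply: eq_shifted => x; rewrite big_cons mul1r mulrA /c.
    by rewrite [_^-1 * _]mulrC divfK.
  move=> /(_ s (fun x xs => xs))/(shifted_lin (-1) Ag).
  have -> : (fun x => g x + -1 * \sum_(lam <- s) c lam * e lam x) =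
            (fun x => g x - \sum_(lam <- s) c lam * e lam x).
    by apply/funext => x; rewrite mulN1r.
  by apply: eq_shifted => x; rewrite mulN1r.
have pS : perp (fun x => h x - S x).
  move=> lam ls; have ce := ccont_psi l lam.
  rewrite dotBl// dot_suml//; last by move=> i; exact/ccontZ/ccont_psi.
  rewrite (bigD1_seq lam)//= big_seq_cond big1 ?addr0.
    by rewrite dotZl// (dot_psi l0 theta1)// ?eqxx ?mulr1 ?subrr//; exact: sZ.
  move=> lam' /andP[ls' neq].
  rewrite (dotZl l0 _ (ccont_psi l lam') ce).
  rewrite (dot_psi l0 theta1 (sZ _ ls') (sZ _ ls)).
  by rewrite (negbTE neq) mulr0.
apply: le_trans (inverse_norm_le Aw pS) _.
rewrite ler_wpM2l ?sqr_ge0//.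
(* Bessel: h - S is orthogonal to S *)
have o : dot S (fun x => h x - S x) = 0.
  rewrite dot_suml//; last 2 first.
  - by move=> i; exact/ccontZ/ccont_psi.
  - exact: ccontB.
  rewrite big_seq big1// => lam ls.
  rewrite dotZl//; [|exact: ccont_psi|exact: ccontB].
  rewrite dotC; [|exact: l0|exact: ccontB|exact: ccont_psi].
  by rewrite pS// conjc0 mulr0.
have hE : sqnorm l h = sqnorm l (fun x => S x + (h x - S x)).
  by congr (sqnorm l); apply/funext => x; rewrite addrC subrK.
rewrite hE (sqnormD l0 cS (ccontB ch cS)).
by rewrite o mulr0 addr0 lerDr sqnorm_ge0.
Qed.

End expansion.

(** * Density of smooth functions in L^2(0, l) *)

Section density.
Variables (R : realType) (l : R).
Hypothesis l0 : 0 < l.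
Implicit Types (f g h k : R -> R) (a b x y : R).
Local Notation mu := (@lebesgue_measure R).
Local Notation I0l := (`]0, l[%classic : set R).

(** The squared L^2 distance of real functions, valued in the extended reals so that measurability
    alone suffices to handle it. *)
Definition dist2 f g : \bar R := (\int[mu]_(x in I0l) ((f x - g x) ^+ 2)%:E)%E.

Lemma mI0l : measurable I0l. Proof. exact: measurable_itv. Qed.

Lemma measurable_sqrB f g : measurable_fun I0l f -> measurable_fun I0l g ->
  measurable_fun I0l (fun x => ((f x - g x) ^+ 2)%:E).
Proof.
move=> mf mg; apply/measurable_EFinP; apply: measurable_funX.
exact: measurable_funB.
Qed.

Lemma dist2_triangle f g h : measurable_fun I0l f -> measurable_fun I0l g ->
  measurable_fun I0l h -> (dist2 f h <= 2%:E * dist2 f g + 2%:E * dist2 g h)%E.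
Proof.
move=> mf mg mh; have mfg := measurable_sqrB mf mg; have mgh := measurable_sqrB mg mh.
rewrite /dist2 -!ge0_integralZl_EFin//=; try by move=> x _; rewrite lee_fin sqr_ge0.
rewrite -ge0_integralD//=; try by move=> x _; rewrite mule_ge0// lee_fin sqr_ge0.
- apply: ge0_le_integral => //=.
  + by move=> x _; rewrite lee_fin sqr_ge0.
  + exact: measurable_sqrB.
  + by apply: emeasurable_funD; exact: measurable_funeM.
  + move=> x _; rewrite -!EFinM -EFinD lee_fin -subr_ge0.
    have -> : 2 * (f x - g x) ^+ 2 + 2 * (g x - h x) ^+ 2 - (f x - h x) ^+ 2 =
      (f x - g x - (g x - h x)) ^+ 2 by ring.
    exact: sqr_ge0.
- exact: measurable_funeM.
- exact: measurable_funeM.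
Qed.

Lemma dist2_trans f g h (e : R) : measurable_fun I0l f -> measurable_fun I0l g ->
  measurable_fun I0l h -> (dist2 f g < (e / 4)%:E)%E -> (dist2 g h < (e / 4)%:E)%E ->
  (dist2 f h < e%:E)%E.
Proof.
move=> mf mg mh fg gh; apply: le_lt_trans (dist2_triangle mf mg mh) _.
have -> : e%:E = (2%:E * (e / 4)%:E + 2%:E * (e / 4)%:E)%E.
  by rewrite -!EFinM -EFinD; congr EFin; field.
by rewrite lteD// lte_pmul2l.
Qed.

Lemma dist2_cvg0 (u : nat -> R -> R) f (G : R -> \bar R) (e : R) :
  (forall n, measurable_fun I0l (u n)) -> measurable_fun I0l f ->
  mu.-integrable I0l G ->
  (forall n x, 0 < x < l -> (((u n x - f x) ^+ 2)%:E <= G x)%E) ->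
  (forall x, 0 < x < l -> u n x @[n --> \oo] --> f x) -> 0 < e ->
  \forall n \near \oo, (dist2 (u n) f < e%:E)%E.
Proof.
move=> mu_ mf iG uG uf e0.
pose F n x : \bar R := ((u n x - f x) ^+ 2)%:E.
have h1 : {ae mu, forall x, I0l x -> F ^~ x @ \oo --> (0 : \bar R)%E}.
  apply: aeW => x /= xl; rewrite in_itv /= in xl.
  have uxf : (u n x - f x) ^+ 2 @[n --> \oo] --> (0 : R).
    rewrite (_ : 0 = (f x - f x) * (f x - f x)); last by rewrite subrr mul0r.
    by apply: cvgM; (apply: cvgB; [exact: uf|exact: cvg_cst]).
  by apply/fine_cvgP; split; [exact: nearW|exact: uxf].
have h2 : {ae mu, forall x n, I0l x -> (`|F n x| <= G x)%E}.
  apply: aeW => x n /= xl; rewrite in_itv /= in xl.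
  by rewrite ger0_norm ?sqr_ge0// uG.
have mF n : measurable_fun I0l (F n) by exact: measurable_sqrB.
have [_ _ H] := @dominated_convergence _ _ _ mu _ mI0l F (fun=> 0%E) G mF (measurable_cst _) h1 iG h2.
rewrite integral_cst ?mul0e in H; last exact: mI0l.
move/fine_cvgP : H => [H1 H2]; have H3 := cvgr_lt _ H2 _ e0.
near=> n; have fi : dist2 (u n) f \is a fin_num by near: n; exact: H1.
rewrite -(fineK fi) lte_fin; near: n; exact: H3.
Unshelve. all: by end_near. Qed.

(** For [n > 0], a trapezoid on [[0, l]]: 0 within [1/n] of an endpoint or outside the interval, 1
    at distance at least [2/n] from both. *)
Definition cutoff (n : nat) x : R :=
  Num.max 0 (Num.min 1 (n%:R * Num.min x (l - x) - 1)).

Definition clip (n : nat) y : R := Num.max (- n%:R) (Num.min n%:R y).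

Lemma continuous_clip n : continuous (clip n).
Proof.
move=> x; rewrite /clip; apply: (@continuous_max _ _ (cst _) (fun y => Num.min n%:R y)).
  exact: cst_continuous.
by apply: (@continuous_min _ _ (cst _) id); [exact: cst_continuous|exact: cvg_id].
Qed.

Lemma continuous_cutoff n : continuous (cutoff n).
Proof.
move=> x; rewrite /cutoff.
apply: (@continuous_max _ _ (cst _) (fun y => Num.min 1 _)); first exact: cst_continuous.
apply: (@continuous_min _ _ (cst _) (fun y => n%:R * Num.min y (l - y) - 1)); first exact: cst_continuous.
apply: cvgB; last exact: cvg_cst; apply: cvgM; first exact: cvg_cst.
apply: (@continuous_min _ _ id (fun y => l - y)); first exact: cvg_id.
by apply: cvgB; [exact: cvg_cst|exact: cvg_id].
Qed.

Lemma cutoff_bound n x : 0 <= cutoff n x <= 1.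
Proof.
rewrite /cutoff le_max lexx /= ge_max ler01 /=.
by rewrite ge_min lexx.
Qed.

Lemma cutoff_eq0 n x : (x <= n.+1%:R^-1) || (l - n.+1%:R^-1 <= x) -> cutoff n.+1 x = 0.
Proof.
move=> h; have n0 : 0 < n.+1%:R :> R by [].
have : n.+1%:R * Num.min x (l - x) <= 1.
  rewrite mulrC -ler_pdivlMr// div1r ge_min.
  case/orP: h => h; apply/orP; first by left.
  by right; rewrite lerBlDr -lerBlDl.
move=> h1; rewrite /cutoff; apply/max_idPl.
by rewrite ge_min subr_le0 h1 orbT.
Qed.

Lemma clip_bound n y : `|clip n y| <= n%:R.
Proof.
have n0 : 0 <= n%:R :> R by [].
rewrite /clip ler_norml le_max lexx /= ge_max ge_min lexx /= andbT.
lra.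
Qed.

Lemma clip_id n y : `|y| <= n%:R -> clip n y = y.
Proof.
rewrite ler_norml => /andP[h1 h2]; rewrite /clip (min_idPr h2).
exact/max_idPr.
Qed.

Lemma clip_cases n y : [\/ y <= - n%:R /\ clip n y = - n%:R,
  - n%:R <= y <= n%:R /\ clip n y = y | n%:R <= y /\ clip n y = n%:R].
Proof.
have n0 : 0 <= n%:R :> R by [].
have [ny|ny] := leP n%:R y.
  by apply: Or33; rewrite /clip (min_idPl ny); split=> //; apply/max_idPr; lra.
have [yn|yn] := leP y (- n%:R).
  by apply: Or31; rewrite /clip (min_idPr (ltW ny)); split=> //; exact/max_idPl.
apply: Or32; rewrite (ltW ny) (ltW yn); split=> //.
by rewrite clip_id// ler_norml (ltW ny) (ltW yn).
Qed.

Lemma clip_lipschitz n y y' : `|clip n y - clip n y'| <= `|y - y'|.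
Proof.
have h1 := ler_norm (y - y'); have h2 := ler_norm (y' - y); rewrite distrC in h2.
have n0 : 0 <= n%:R :> R by [].
move: h1 h2 (clip_cases n y) (clip_cases n y').
set t := `|y - y'|; move: (clip n y) (clip n y') => c c'; move: n%:R n0 => N N0 h1 h2.
rewrite ler_norml => -[[? ->]|[/andP[? ?] ->]|[? ->]] -[[? ->]|[/andP[? ?] ->]|[? ->]];
by apply/andP; split; lra.
Qed.

Lemma continuous_measurable_I0l f : continuous f -> measurable_fun I0l f.
Proof. by move=> cf; apply: measurable_funTS; exact: continuous_measurable_fun. Qed.

Lemma mu_I0l_fin : (mu I0l < +oo)%E.
Proof. by rewrite lebesgue_measure_itv /= lte_fin l0 ltry. Qed.

Lemma measurable_clip n f : measurable_fun I0l f -> measurable_fun I0l (fun x => clip n (f x)).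
Proof.
move=> mf; apply: (@measurable_maxr _ _ _ _ (cst _) (fun x => Num.min n%:R (f x))).
  exact: measurable_cst.
by apply: (@measurable_minr _ _ _ _ (cst _) f).
Qed.

Lemma measurable_cutoff n : measurable_fun I0l (cutoff n).
Proof. by apply: continuous_measurable_I0l; exact: continuous_cutoff. Qed.

Lemma cutoff_clip_approx f (e : R) : measurable_fun I0l f ->
  (\int[mu]_(x in I0l) ((f x) ^+ 2)%:E < +oo)%E -> 0 < e ->
  exists n, (dist2 (fun x => cutoff n.+1 x * clip n.+1 (f x))%R f < e%:E)%E.
Proof.
move=> mf ff e0.
pose u n x := cutoff n.+1 x * clip n.+1 (f x).
have mu_ n : measurable_fun I0l (u n).
  apply: measurable_funM; last exact: measurable_clip.
  exact: measurable_cutoff.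
have iG : mu.-integrable I0l (fun x => ((f x) ^+ 2)%:E).
  apply/integrableP; split; first by apply/measurable_EFinP; exact: measurable_funX.
  by under eq_integral do rewrite gee0_abs ?lee_fin ?sqr_ge0//.
have bG n x : 0 < x < l -> (((u n x - f x) ^+ 2)%:E <= ((f x) ^+ 2)%:E)%E.
  move=> _; rewrite lee_fin /u.
  have /andP[c0 c1] := cutoff_bound n.+1 x.
  have n0 : 0 <= n.+1%:R :> R by [].
  have := clip_cases n.+1 (f x); move: n.+1%:R n0 (cutoff n.+1 x) c0 c1 (f x) (clip n.+1 (f x)).
  move=> N N0 c c0 c1 y t tP.
  (* [y^2 - (c t - y)^2 = c t (2 y - c t)], nonnegative because [c t] lies between 0 and [y]; so
     [f^2] dominates. *)
  have p0 : 0 <= c * t * (2 * y - c * t).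
    have cN := ler_wpM2r N0 c1; rewrite mul1r in cN.
    have cN0 := mulr_ge0 c0 N0.
    case: tP => [[yN ->]|[_ ->]|[yN ->]].
    - by rewrite mulrN mulr_le0//; lra.
    - have -> : c * y * (2 * y - c * y) = c * (2 - c) * y ^+ 2 by ring.
      by apply: mulr_ge0; [apply: mulr_ge0 => //; lra|exact: sqr_ge0].
    - by rewrite mulr_ge0//; lra.
  by rewrite -subr_ge0 (_ : _ - _ = c * t * (2 * y - c * t))//; ring.
have cv x : 0 < x < l -> u n x @[n --> \oo] --> f x.
  move=> /andP[x0 xl]; apply: cvg_near_cst.
  pose m := Num.min x (l - x).
  have m0 : 0 < m by rewrite lt_min x0 subr_gt0.
  near=> n.
  rewrite /u clip_id; last first.
    rewrite (@le_trans _ _ n%:R)// ?ler_nat//; near: n; exact: nbhs_infty_ger.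
  rewrite /cutoff -/m (min_idPl _) ?(max_idPr _) ?mul1r//.
  rewrite lerBrDr -ler_pdivrMr// (@le_trans _ _ n%:R)// ?ler_nat//.
  near: n; exact: nbhs_infty_ger.
have [N _ NP] := dist2_cvg0 mu_ mf iG bG cv e0.
by exists N; exact: NP (leqnn N).
Unshelve. all: by end_near. Qed.

(** The clipped function is bounded, hence approximable in L^1 by continuous functions. As clipping
    is a contraction and bounds differences by [2 n], the squared L^2 distance is at most [2 n]
    times the L^1 distance. *)
Lemma continuous_approx n f (e : R) : measurable_fun I0l f -> 0 < e ->
  exists2 g, continuous g &
  (dist2 (fun x => cutoff n x * clip n (f x))%R (fun x => cutoff n x * clip n (g x))%R < e%:E)%E.
Proof.
move=> mf e0; have mcf := measurable_clip n mf.
have icf : mu.-integrable I0l (EFin \o (fun x => clip n (f x))).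
  apply: measurable_bounded_integrable => //; first exact: mu_I0l_fin.
  exists n%:R; split; first exact: num_real.
  by move=> M nM x _ /=; rewrite (le_trans (clip_bound _ _))// ltW.
have [g_ [cg ig gf]] := approximation_continuous_integrable mI0l mu_I0l_fin icf.
(* Chosen so that [2 n d < e]; the [+ 1] covers [n = 0]. *)
pose d : R := e / (2 * n%:R + 1).
have d0 : 0 < d by rewrite divr_gt0// ltr_wpDl// mulr_ge0.
have [N] : exists N, (\int[mu]_(z in I0l) `|(clip n (f z) - g_ N z)%:E| < d%:E)%E.
  move/fine_cvgP : gf => [H1 H2]; have H3 := cvgr_lt _ H2 _ d0.
  near \oo => N; exists N.
  have fi : (\int[mu]_(z in I0l) `|(clip n (f z) - g_ N z)%:E|)%E \is a fin_num by near: N; exact: H1.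
  by rewrite -(fineK fi) lte_fin; near: N; exact: H3.
move=> dN; exists (g_ N); first exact: cg.
have mg := continuous_measurable_I0l (cg N).
have mfg : measurable_fun I0l (fun z => `|clip n (f z) - g_ N z|).
  by apply: measurableT_comp => //; exact: measurable_funB.
apply: (@le_lt_trans _ _ ((2 * n%:R)%R%:E * \int[mu]_(z in I0l) `|(clip n (f z) - g_ N z)%:E|)%E); last first.
  apply: (@le_lt_trans _ _ ((2 * n%:R)%R%:E * d%:E)%E).
    by rewrite lee_wpmul2l ?lee_fin ?mulr_ge0// ltW.
  rewrite -EFinM lte_fin /d mulrCA gtr_pMr//.
  by rewrite ltr_pdivrMr ?mul1r ?ltrDl// ltr_wpDl// mulr_ge0.
rewrite -ge0_integralZl_EFin//=; last exact/measurable_EFinP.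
apply: ge0_le_integral => //=.
- by move=> x _; rewrite lee_fin sqr_ge0.
- apply: measurable_sqrB; apply: measurable_funM => //; try exact: measurable_clip;
  exact: measurable_cutoff.
- by apply: measurable_funeM; exact/measurable_EFinP.
move=> x _; rewrite -EFinM lee_fin -mulrBr exprMn.
have /andP[c0 c1] := cutoff_bound n x.
have cc1 : cutoff n x ^+ 2 <= 1 by rewrite expr_le1.
have s0 := sqr_ge0 (clip n (f x) - clip n (g_ N x)).
apply: (@le_trans _ _ ((clip n (f x) - clip n (g_ N x)) ^+ 2)).
  by rewrite ler_piMl.
rewrite -(real_normK (num_real _)) expr2 ler_pM//.
  by rewrite (le_trans (ler_normB _ _))// mulr_natl mulr2n lerD// clip_bound.
have := clip_lipschitz n (clip n (f x)) (g_ N x).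
by rewrite [clip n (clip _ _)]clip_id// clip_bound.
Unshelve. all: by end_near. Qed.

(* The mean of k over [x, x + d] gains one derivative and, by dominated
   convergence, tends to k in L^2(0, l) as d -> 0. *)
Lemma mean_approx k a b (M e : R) : continuous k -> (forall x, `|k x| <= M) ->
  (forall x, x <= a -> k x = 0) -> (forall x, b <= x -> k x = 0) ->
  0 < e -> forall d0, 0 < d0 -> exists d g,
  [/\ 0 < d, (forall x, is_derive x 1 g (d^-1 * (k (x + d) - k x))),
      (forall x, `|g x| <= M),
      (forall x, x <= a - d0 -> g x = 0) /\ (forall x, b <= x -> g x = 0) &
      (dist2 g k < e%:E)%E].
Proof.
move=> ck kM ka kb e0 d0 d00.
have [F F0 dF] := antiderivative ck.
have cF := derive_continuous dF.
pose A (n : nat) : R := n.+1%:R^-1.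
pose u n x : R := (A n)^-1 * (F (x + A n) - F x).
have A0 n : 0 < A n by rewrite invr_gt0.
have duh n x : is_derive x 1 (u n) ((A n)^-1 * (k (x + A n) - k x)).
  exact: is_derive_increment.
(* Each mean is a value of [k] within [A n] to the right of [x]; the bound by [M], the support and
   the pointwise convergence all follow from this. *)
have mvt n x : exists2 c, x < c < x + A n & u n x = k c.
  have xA : x < x + A n by rewrite ltrDl.
  have [c] := MVT xA (fun y _ => dF y) (continuous_subspaceT cF).
  rewrite in_itv /= => cx; rewrite addrAC subrr add0r => E; exists c => //.
  by rewrite /u E mulrC mulfK// gt_eqF.
have uM n x : `|u n x| <= M by have [c _ ->] := mvt n x.
have cu n : continuous (u n) := derive_continuous (duh n).
have mu_ n := continuous_measurable_I0l (cu n).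
pose G : R -> \bar R := EFin \o (fun x : R => (2 * M) ^+ 2).
have iG : mu.-integrable I0l G.
  by apply: continuous_integrable_itv => x; exact: cvg_cst.
have bG n x : 0 < x < l -> (((u n x - k x) ^+ 2)%:E <= G x)%E.
  move=> _; rewrite lee_fin /= -(real_normK (num_real (_ - _))) lerXn2r ?nnegrE//.
    by rewrite mulr_ge0// (le_trans _ (kM 0)).
  by rewrite (le_trans (ler_normB _ _))// mulr_natl mulr2n lerD.
have cv x : 0 < x < l -> u n x @[n --> \oo] --> k x.
  move=> _; apply/cvgrPdist_lt => r r0.
  have /cvgrPdist_lt/(_ r r0)/nbhs_ballP[t /= t0 tP] := ck x.
  near=> n; have [c /andP[xc cA] ->] := mvt n x.
  apply: tP; rewrite /ball /= ltr_norml; apply/andP; split.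
    have : A n < t by near: n; exact: (near_infty_natSinv_lt (PosNum t0)).
    lra.
  lra.
have uk := dist2_cvg0 mu_ (continuous_measurable_I0l ck) iG bG cv e0.
near \oo => n.
exists (A n), (u n); split=> //.
(* The mean looks only to the right, so the support grows by less than [d0] on the left and not at
   all on the right. *)
- split=> x xa; have [c /andP[c1 c2] ->] := mvt n x; [apply: ka|apply: kb; lra].
  have : A n < d0 by near: n; exact: (near_infty_natSinv_lt (PosNum d00)).
  lra.
- by near: n.
Unshelve. all: by end_near. Qed.

Lemma dist2C f g : dist2 f g = dist2 g f.
Proof. by apply: eq_integral => x _; rewrite -sqrrN opprB. Qed.

Lemma continuous_increment k (d : R) : continuous k ->
  continuous (fun x => d^-1 * (k (x + d) - k x)).
Proof.
move=> ck x; apply: cvgM; first exact: cvg_cst.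
apply: cvgB; last exact: ck.
have cs : (fun y => y + d) @ x --> x + d by apply: cvgD; [exact: cvg_id|exact: cvg_cst].
exact: (cvg_comp _ _ cs (ck (x + d))).
Qed.

(** Cut off and clip, approximate by a continuous function, then take means three times. Each mean
    moves the left edge [a] of the support by at most [a / 4], so the result still vanishes near
    both endpoints, and so does its derivative there. *)
Lemma C3_approx f (e : R) : measurable_fun I0l f ->
  (\int[mu]_(x in I0l) ((f x) ^+ 2)%:E < +oo)%E -> 0 < e ->
  exists g g1 g2 g3 : R -> R,
  [/\ [/\ (forall x, is_derive x 1 g (g1 x)), (forall x, is_derive x 1 g1 (g2 x)),
          (forall x, is_derive x 1 g2 (g3 x)) & continuous g3],
      [/\ g 0 = 0, g l = 0, g1 0 = 0 & g1 l = 0] &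
      (dist2 f g < e%:E)%E].
Proof.
move=> mf ff e0.
have e4 (r : R) : 0 < r -> 0 < r / 4 by move=> r0; rewrite divr_gt0.
(* Each [dist2_trans] costs a factor 4, hence one quarter of the previous tolerance per stage; the
   last two means share the smallest one. *)
have e1 := e4 _ e0; have e2 := e4 _ e1; have e3 := e4 _ e2; have e5 := e4 _ e3.
have [n nf] := cutoff_clip_approx mf ff e1.
have [h ch hf] := continuous_approx n.+1 mf e2.
pose k x := cutoff n.+1 x * clip n.+1 (h x).
have ck : continuous k.
  move=> x; apply: cvgM; first exact: continuous_cutoff.
  exact: (cvg_comp _ _ (ch x) (@continuous_clip n.+1 (h x))).
have kM x : `|k x| <= n.+1%:R.
  have /andP[c0 c1] := cutoff_bound n.+1 x.
  rewrite normrM (ger0_norm c0) -[leRHS]mul1r ler_pM//.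
  exact: clip_bound.
pose a : R := n.+1%:R^-1; have a0 : 0 < a by rewrite invr_gt0.
have ka x : x <= a -> k x = 0 by move=> xa; rewrite /k cutoff_eq0 ?xa// mul0r.
have kb x : l - a <= x -> k x = 0 by move=> xb; rewrite /k cutoff_eq0 ?xb ?orbT// mul0r.
have a4 := e4 _ a0.
have [d1 [k1 [d10 dk1 k1M [k1a k1b] kk1]]] := mean_approx ck kM ka kb e3 a4.
have [d2 [k2 [d20 dk2 k2M [k2a k2b] kk2]]] := mean_approx (derive_continuous dk1) k1M k1a k1b e5 a4.
have [d3 [k3 [d30 dk3 k3M [k3a k3b] kk3]]] := mean_approx (derive_continuous dk2) k2M k2a k2b e5 a4.
pose k1' x := d1^-1 * (k (x + d1) - k x).
pose k2' x := d2^-1 * (k1 (x + d2) - k1 x).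
pose k2'' x := d2^-1 * (k1' (x + d2) - k1' x).
pose k3' x := d3^-1 * (k2 (x + d3) - k2 x).
pose k3'' x := d3^-1 * (k2' (x + d3) - k2' x).
exists k3, k3', k3'', (fun x => d3^-1 * (k2'' (x + d3) - k2'' x)); split.
- split=> [x|x|x|]; first exact: dk3.
  + exact: is_derive_increment.
  + by apply: is_derive_increment => y; exact: is_derive_increment.
  + by apply: continuous_increment; apply: continuous_increment; exact: continuous_increment.
- split; [by apply: k3a; lra|by apply: k3b; lra| |].
  + apply: (is_derive_near0 (dk3 0)); near=> x; apply: k3a; apply: ltW.
    by near: x; apply: lt_nbhsl; lra.
  + apply: (is_derive_near0 (dk3 l)); near=> x; apply: k3b; apply: ltW.
    by near: x; apply: lt_nbhsr; lra.
have mk := continuous_measurable_I0l ck.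
have mk1 := continuous_measurable_I0l (derive_continuous dk1).
have mk2 := continuous_measurable_I0l (derive_continuous dk2).
have mk3 := continuous_measurable_I0l (derive_continuous dk3).
have mcf : measurable_fun I0l (fun x => cutoff n.+1 x * clip n.+1 (f x)).
  by apply: measurable_funM; [exact: measurable_cutoff|exact: measurable_clip].
rewrite dist2C in nf; rewrite dist2C in kk1; rewrite dist2C in kk2; rewrite dist2C in kk3.
apply: (dist2_trans mf mcf mk3 nf).
apply: (dist2_trans mcf mk mk3 hf).
apply: (dist2_trans mk mk1 mk3 kk1).
exact: (dist2_trans mk1 mk2 mk3 kk2 kk3).
Unshelve. all: by end_near. Qed.

End density.

(** * The orthonormal basis *)

Section basis.
Variables (R : realType) (l : R) (theta : R[i]).
Hypothesis l0 : 0 < l.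
Hypothesis theta1 : Normc.normc theta = 1.
Implicit Types (f g h u v w y : R -> R[i]) (x lam : R).
Local Notation C := R[i].
Local Notation Re := complex.Re.
Local Notation Im := complex.Im.
Local Notation normc := Normc.normc.
Local Notation mu := (@lebesgue_measure R).
Local Notation I0l := (`]0, l[%classic : set R).
Local Notation Z := (real_zeros l theta).

Lemma ccont_measurable f : ccont f ->
  measurable_fun I0l (fun x => Re (f x)) /\ measurable_fun I0l (fun x => Im (f x)).
Proof. by move=> [fr fi]; split; exact: continuous_measurable_I0l. Qed.

Lemma integral_normc f : ccont f ->
  (\int[mu]_(x in I0l) (normc (f x) ^+ 2)%:E)%E = (sqnorm l f)%:E.
Proof.
move=> cf; rewrite /sqnorm /Rintegral fineK//.
exact/integrable_fin_num/continuous_integrable_itv/continuous_sqr_normc.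
Qed.

Lemma ccont_L2 f : ccont f -> L2 l f.
Proof.
move=> cf; have [mr mi] := ccont_measurable cf.
by split=> //; rewrite integral_normc// ltry.
Qed.

Lemma integral_normcE f : measurable_fun I0l (fun x => Re (f x)) ->
  measurable_fun I0l (fun x => Im (f x)) ->
  (\int[mu]_(x in I0l) (normc (f x) ^+ 2)%:E)%E =
  (\int[mu]_(x in I0l) ((Re (f x)) ^+ 2)%:E + \int[mu]_(x in I0l) ((Im (f x)) ^+ 2)%:E)%E.
Proof.
move=> mr mi; rewrite -ge0_integralD//=.
- by apply: eq_integral => x _; rewrite sqr_normcE EFinD.
- by move=> x _; rewrite lee_fin sqr_ge0.
- by apply/measurable_EFinP; exact: measurable_funX.
- by move=> x _; rewrite lee_fin sqr_ge0.
- by apply/measurable_EFinP; exact: measurable_funX.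
Qed.

Lemma AC2_cder f g : ccont g -> cder f g -> AC2 l f g.
Proof.
move=> cg df; split; first exact: ccont_L2.
move=> x; rewrite in_itv /= => /andP[x0 _].
by rewrite (Cintegral_der x0 cg df) addrC subrK.
Qed.

Lemma psi_eigenfunction lam : Z lam -> L0_eigenfunction l theta (psi l lam).
Proof.
move=> Zl; split.
  move=> p0; have := sqnorm_psi l0 lam; rewrite /sqnorm /Rintegral.
  have cp := ccont_psi l lam; have [mr mi] := ccont_measurable cp.
  rewrite (@ae_eq_integral _ _ _ mu I0l (cst 0%E)).
  - by rewrite integral0 /= => /eqP; rewrite eq_sym oner_eq0.
  - exact: mI0l.
  - by apply/measurable_EFinP; apply: continuous_measurable_I0l; exact: continuous_sqr_normc.
  - exact: measurable_cst.
  - case: p0 => A [mA A0 sA]; exists A; split=> // x /= nx; apply: sA => /= px.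
    by apply: nx => xl; rewrite px// Normc.normc0 expr0n.
exists (lam ^+ 3)%:C.
have [w1 [w2 [w3 [[dw dw1 dw2 cw3] bc E]]]] := shifted_psi (lam ^+ 3) Zl.
exists w1, w2, w3; split=> //.
  split; [apply: AC2_cder dw|apply: AC2_cder dw1|exact: AC2_cder dw2] => //.
    exact: cder_ccont dw1.
  exact: cder_ccont dw2.
apply: aeW => x _; have := E x; rewrite subrr mul0r => /esym/eqP.
by rewrite subr_eq0 => /eqP.
Qed.

Lemma C3_approx_complex f (e : R) : L2 l f -> 0 < e ->
  exists g g1 g2 g3,
  [/\ [/\ cder g g1, cder g1 g2, cder g2 g3 & ccont g3],
      [/\ g 0 = 0, g l = 0, g1 0 = 0 & g1 l = 0],
      (dist2 l (fun x => Re (f x)) (fun x => Re (g x)) < e%:E)%E &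
      (dist2 l (fun x => Im (f x)) (fun x => Im (g x)) < e%:E)%E].
Proof.
move=> [mr mi ff] e0; rewrite integral_normcE// in ff.
have [fr fi] : (\int[mu]_(x in I0l) ((Re (f x)) ^+ 2)%:E < +oo)%E /\
               (\int[mu]_(x in I0l) ((Im (f x)) ^+ 2)%:E < +oo)%E.
  by split; apply: le_lt_trans ff; [apply: leeDl|apply: leeDr];
    apply: integral_ge0 => x _; rewrite lee_fin sqr_ge0.
have [a [a1 [a2 [a3 [[da da1 da2 ca3] [a00 al a10 a1l] ea]]]]] := C3_approx l0 mr fr e0.
have [b [b1 [b2 [b3 [[db db1 db2 cb3] [b00 bl b10 b1l] eb]]]]] := C3_approx l0 mi fi e0.
exists (fun x => a x +i* b x), (fun x => a1 x +i* b1 x), (fun x => a2 x +i* b2 x),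
  (fun x => a3 x +i* b3 x); split=> //.
- by split=> // x; split=> /=.
- by rewrite a00 al a10 a1l b00 bl b10 b1l.
Qed.

Lemma psi_dense f (eps : R) : L2 l f -> 0 < eps ->
  exists (s : seq R) (c : R -> C), (forall i, i \in s -> Z i) /\
    L2norm l (fun x => f x - \sum_(i <- s) c i * psi l i x) < eps.
Proof.
move=> Lf eps0; have [mr mi _] := Lf.
(* [eps^2 / 8 = (eps^2 / 2) / 4]: [dist2_trans] through [g] loses the 4, and the real and imaginary
   parts then get [eps^2 / 2] each. *)
pose e := eps ^+ 2 / 8; have e0 : 0 < e by rewrite divr_gt0// exprn_gt0.
have [g [g1 [g2 [g3 [[dg dg1 dg2 cg3] [g00 gl g10 g1l] er ei]]]]] := C3_approx_complex Lf e0.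
have [lam0 nZ] := exists_nonzero l0 theta1.
pose h x := 'i%C * g3 x - (lam0 ^+ 3)%:C * g x.
(* [g] and [g'] vanish at both endpoints, so [g] satisfies the boundary conditions for every [theta]
   and lies in the range of the resolvent. *)
have Ag : shifted l theta (lam0 ^+ 3) g h.
  by exists g1, g2, g3; split=> //; rewrite g1l g10 mulr0.
have [cg ch] := shifted_ccont Ag.
(* The threshold in the expansion, making [r^2 * sqnorm l h < e]; the [+ 1] covers [h = 0]. *)
pose r := Num.sqrt (e / (sqnorm l h + 1)).
have Nh : 0 < sqnorm l h + 1 by rewrite ltr_wpDl// sqnorm_ge0.
have r0 : 0 < r by rewrite sqrtr_gt0 divr_gt0.
have r2 : r ^+ 2 * sqnorm l h < e.
  rewrite sqr_sqrtr; last by rewrite ltW// divr_gt0.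
  by rewrite mulrAC ltr_pdivrMr// ltr_pM2l// ltrDl.
have [s [us sP]] := finite_zeros l0 theta1 (lam0 ^+ 3) r^-1.
have [c cP] := expansion_approx l0 theta1 nZ r0 us sP Ag.
exists s, c; split; first by move=> i /sP[].
pose S x := \sum_(i <- s) c i * psi l i x.
have cS : ccont S by apply: ccont_sum => i; exact/ccontZ/ccont_psi.
have cgS := ccontB cg cS.
have gS : (\int[mu]_(x in I0l) (normc (g x - S x) ^+ 2)%:E < e%:E)%E.
  by rewrite integral_normc// lte_fin (le_lt_trans cP).
have [mgr mgi] := ccont_measurable cg; have [mSr mSi] := ccont_measurable cS.
have [mgSr mgSi] := ccont_measurable cgS.
rewrite integral_normcE// in gS.
have gSr : (dist2 l (fun x => Re (g x)) (fun x => Re (S x)) < e%:E)%E.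
  apply: le_lt_trans gS; rewrite /dist2.
  under eq_integral do rewrite -cReN -cReD.
  by apply: leeDl; apply: integral_ge0 => x _; rewrite lee_fin sqr_ge0.
have gSi : (dist2 l (fun x => Im (g x)) (fun x => Im (S x)) < e%:E)%E.
  apply: le_lt_trans gS; rewrite /dist2.
  under eq_integral do rewrite -cImN -cImD.
  by apply: leeDr; apply: integral_ge0 => x _; rewrite lee_fin sqr_ge0.
have e4 : e = eps ^+ 2 / 2 / 4 by rewrite /e; field.
rewrite e4 in er ei gSr gSi.
have fSr := dist2_trans mr mgr mSr er gSr.
have fSi := dist2_trans mi mgi mSi ei gSi.
have fS : (\int[mu]_(x in I0l) (normc (f x - S x) ^+ 2)%:E < (eps ^+ 2)%:E)%E.
  have ReB : (fun x => Re (f x - S x)) = (fun x => Re (f x) - Re (S x)).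
    by apply/funext => x; rewrite cReD cReN.
  have ImB : (fun x => Im (f x - S x)) = (fun x => Im (f x) - Im (S x)).
    by apply/funext => x; rewrite cImD cImN.
  rewrite integral_normcE ?ReB ?ImB; [|exact: measurable_funB..].
  have -> : (eps ^+ 2)%:E = ((eps ^+ 2 / 2)%:E + (eps ^+ 2 / 2)%:E)%E.
    by rewrite -EFinD; congr EFin; field.
  apply: lteD.
    by under eq_integral do rewrite cReD cReN.
  by under eq_integral do rewrite cImD cImN.
rewrite /L2norm -[ltRHS](ger0_norm (ltW eps0)) -sqrtr_sqr ltr_sqrt ?exprn_gt0//.
have fn : (\int[mu]_(x in I0l) (normc (f x - S x) ^+ 2)%:E)%E \is a fin_num.
  rewrite ge0_fin_numE; first by rewrite (lt_trans fS)// ltry.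
  by apply: integral_ge0 => x _; rewrite lee_fin sqr_ge0.
by rewrite -lte_fin /Rintegral fineK.
Qed.

End basis.

Theorem corollary1p1 (R : realType) (l : R) (theta : R[i])
  (hl : 0 < l) (htheta : Normc.normc theta = 1) :
  (forall lambda : R, real_zeros l theta lambda ->
     L0_eigenfunction l theta (psi l lambda)) /\
  orthonormal_basis l (real_zeros l theta) (psi l).
Proof.
split; first by move=> lam; exact: psi_eigenfunction.
split.
- by move=> lam _; apply: ccont_L2 => //; exact: ccont_psi.
- by move=> lam lam' Zl Zl'; rewrite (dot_psi hl htheta).
- by move=> f Lf eps eps0; exact: psi_dense.
Qed.
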